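(* Let $X\sim N(\mu_X,1)$ and $Y\sim N(\mu_Y,1)$ be independent, with $\mu_X,\mu_Y\in\mathbb{R}$, and let $Z = XY$. (i) Let $W$ be a real-valued random variable whose first three moments are equal to those of $Z$. Then $W$ is equal in law to $Z$ if and only if $$\mathbb{E}\big[W f^{(4)}(W) + f^{(3)}(W) - (2W + \mu_X\mu_Y) f''(W) - (1+\mu_X^2+\mu_Y^2) f'(W) + (W - \mu_X\mu_Y) f(W)\big] = 0$$ for all functions $f\in C^4(\mathbb{R})$ such that $\mathbb{E}|Z f^{(j)}(Z)| < \infty$ for $0\le j\le 4$ and $\mathbb{E}|f^{(k)}(Z)| < \infty$ for $0\le k\le 3$. (ii) Now suppose that $\mu_X = \mu_Y = \mu$, and that $W$ is a real-valued random variable whose first two moments are equal to those of $Z$. Then $W$ is equal in law to $Z$ if and only if $$\mathbb{E}\big[W f^{(3)}(W) + (1-W) f''(W) - (W + 1 + \mu^2) f'(W) + (W - \mu^2) f(W)\big] = 0$$ for all $f\in C^3(\mathbb{R})$ such that $\mathbb{E}|Z f^{(j)}(Z)| < \infty$ for $0\le j\le 3$ and $\mathbb{E}|f^{(k)}(Z)| < \infty$ for $0\le k\le 2$.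
   Context: $f^{(0)}\equiv f$, and $f^{(j)}$ denotes the $j$-th derivative of $f$. $N(\mu,1)$ denotes the normal distribution with mean $\mu$ and variance $1$. *)

(* Defs.v *)
From HB Require Import structures.
From mathcomp Require Import all_boot all_order all_algebra.
From mathcomp Require Import all_classical all_reals all_analysis.

Set Implicit Arguments.
Unset Strict Implicit.
Unset Printing Implicit Defensive.

Import Order.TTheory GRing.Theory Num.Theory.
Import numFieldNormedType.Exports.

Local Open Scope classical_set_scope.
Local Open Scope ring_scope.

(* Laws are compared on measurable sets only: [distribution] and [normal_prob]
   are total functions, with meaningless values on the other sets. *)
Definition has_law d (T : measurableType d) (R : realType)
    (P : probability T R) (X : {RV P >-> R}) (nu : set R -> \bar R) : Prop :=
  forall A : set R, measurable A -> distribution P X A = nu A.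

Definition equal_in_law d (T : measurableType d) d' (T' : measurableType d')
    (R : realType) (P : probability T R) (X : {RV P >-> R})
    (Q : probability T' R) (Y : {RV Q >-> R}) : Prop :=
  has_law X (distribution Q Y).

Definition independent_RV d (T : measurableType d) (R : realType)
    (P : probability T R) (X Y : {RV P >-> R}) : Prop :=
  forall A B : set R, measurable A -> measurable B ->
    P (X @^-1` A `&` Y @^-1` B) = (P (X @^-1` A) * P (Y @^-1` B))%E.

(* Integrability is stated explicitly so that the identity does not depend on
   the values the total operator 'E_P takes when no expectation exists. *)
Definition has_expectation d (T : measurableType d) (R : realType)
    (P : probability T R) (g : T -> R) (r : \bar R) : Prop :=
  P.-integrable [set: T] (EFin \o g) /\ ('E_P[g] = r)%E.

Definition equal_moments d (T : measurableType d) d' (T' : measurableType d')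
    (R : realType) (n : nat) (P : probability T R) (W : {RV P >-> R})
    (Q : probability T' R) (Z : {RV Q >-> R}) : Prop :=
  forall k : nat, (0 < k <= n)%N ->
    has_expectation P (fun t => W t ^+ k) 'E_Q[fun t => (Z t ^+ k)%R].

Definition class_C (R : realType) (n : nat) (f : R -> R) : Prop :=
  (forall (j : nat) (x : R), (j < n)%N -> derivable (derive1n j f) x 1) /\
  (forall j : nat, (j <= n)%N -> continuous (derive1n j f)).

(* Main.v *)
(* Necessity.  For independent X ~ N(muX, 1) and Y ~ N(muY, 1), Stein's identity
   E[(Y - muY) h(X, Y)] = E[d_Y h(X, Y)], and its analogue in X, applied to
   h = g(XY), X g(XY), Y g(XY) with g a derivative of f, give mean-zero integrands
   of which both operators applied to f are linear combinations.  This requires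
   f and its derivatives to be bounded; a general f is first multiplied by the
   cutoff (1 - x/m)_+^5 (1 + x/m)_+^5, and m tends to infinity by dominated
   convergence, which uses exactly the integrability assumed of f.

   Sufficiency.  Taking f = cos(y x) and f = sin(y x) in the identity yields a
   linear first-order equation phi' = (al + i be) phi for the characteristic
   function phi of W, which that of Z also satisfies.  Since al <= 0 on
   [0, +oo[, the squared modulus of the difference is nonincreasing there, hence
   zero.

   Uniqueness of characteristic functions.  Integrating exp(i t y (W - a)) over a
   standard normal t shows that phi determines E[exp(- y^2 (W - a)^2 / 2)] for
   all a, hence the law of W smoothed by a Gaussian of small variance, hence the
   probabilities of the rays ]b, +oo[. *)

Require Import Defs.
From HB Require Import structures.
From mathcomp Require Import all_boot all_order all_algebra.
From mathcomp Require Import all_classical all_reals all_analysis.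
From mathcomp Require Import measurable_realfun ring lra.

Set Implicit Arguments.
Unset Strict Implicit.
Unset Printing Implicit Defensive.

Import Order.TTheory GRing.Theory Num.Theory.
Import numFieldNormedType.Exports.

Local Open Scope classical_set_scope.
Local Open Scope ring_scope.

(** * Integrals against a normal law *)

Lemma integrable_le d (T : measurableType d) (R : realType)
    (mu : {measure set T -> \bar R}) (f g : T -> R) :
  measurable_fun [set: T] f -> (forall x, `|f x| <= g x) ->
  mu.-integrable [set: T] (EFin \o g) -> mu.-integrable [set: T] (EFin \o f).
Proof.
move=> mf fg; apply: le_integrable => //; first exact/measurable_EFinP.
by move=> x _; rewrite lee_fin (le_trans (fg x))// ler_norm.
Qed.

Section integrable_real.
Context d (T : measurableType d) (R : realType) (mu : {measure set T -> \bar R}).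
Implicit Types f g : T -> R.

Lemma integrable_EFinZl c f : mu.-integrable [set: T] (EFin \o f) ->
  mu.-integrable [set: T] (EFin \o (fun x => c * f x)).
Proof. exact: (@integrableZl _ _ _ mu _ measurableT c (EFin \o f)). Qed.

Lemma integrable_EFinD f g : mu.-integrable [set: T] (EFin \o f) ->
  mu.-integrable [set: T] (EFin \o g) ->
  mu.-integrable [set: T] (EFin \o (fun x => f x + g x)).
Proof.
exact: (@integrableD _ _ _ mu _ measurableT (EFin \o f) (EFin \o g)).
Qed.

Lemma integrable_EFinB f g : mu.-integrable [set: T] (EFin \o f) ->
  mu.-integrable [set: T] (EFin \o g) ->
  mu.-integrable [set: T] (EFin \o (fun x => f x - g x)).
Proof.
exact: (@integrableB _ _ _ mu _ measurableT (EFin \o f) (EFin \o g)).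
Qed.

Lemma Rintegral_dominated_cvg (f_ : nat -> T -> R) f g :
  (forall n, measurable_fun [set: T] (f_ n)) ->
  (forall x, f_ n x @[n --> \oo] --> f x) ->
  mu.-integrable [set: T] (EFin \o g) -> (forall n x, `|f_ n x| <= g x) ->
  \int[mu]_x f_ n x @[n --> \oo] --> \int[mu]_x f x.
Proof.
move=> mf f_f ig f_g.
have cvgE x : ((f_ n x)%:E @[n --> \oo] --> (f x)%:E)%E.
  by apply: cvg_EFin; [exact: nearW|exact: f_f].
have mf_ n : measurable_fun [set: T] (EFin \o f_ n) by exact/measurable_EFinP.
have mfE : measurable_fun [set: T] (EFin \o f).
  by apply: (emeasurable_fun_cvg (fun n => EFin \o f_ n)) => // x _; exact: cvgE.
have f_gE n x : [set: T] x -> (`|(f_ n x)%:E| <= (g x)%:E)%E.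
  by move=> _; rewrite lee_fin.
have [intf _ h] := @dominated_convergence _ _ _ mu _ measurableT
  (fun n => EFin \o f_ n) (EFin \o f) (EFin \o g) mf_ mfE
  (aeW _ (fun x _ => cvgE x)) ig (aeW _ (fun x n => f_gE n x)).
apply: fine_cvg; rewrite fineK; first exact: h.
exact: integrable_fin_num.
Qed.

(** Integrability is bundled with the vanishing integral, so that linear combinations of such
    functions can be formed without side conditions. *)
Definition mean0 (f : T -> R) :=
  mu.-integrable [set: T] (EFin \o f) /\ \int[mu]_x f x = 0.

Lemma mean0D f g : mean0 f -> mean0 g -> mean0 (fun x => f x + g x).
Proof.
move=> [intf f0] [intg g0]; split; first exact: integrable_EFinD.
by rewrite RintegralD// f0 g0 addr0.
Qed.

Lemma mean0Z c f : mean0 f -> mean0 (fun x => c * f x).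
Proof.
move=> [intf f0]; split; first exact: integrable_EFinZl.
by rewrite RintegralZl// f0 mulr0.
Qed.

Lemma mean0B f g : mean0 f -> mean0 g -> mean0 (fun x => f x - g x).
Proof.
move=> [intf f0] [intg g0]; split; first exact: integrable_EFinB.
by rewrite RintegralB// f0 g0 subr0.
Qed.

End integrable_real.

(** * Normal laws as densities with respect to Lebesgue measure *)

Section normal_density.
Context {R : realType}.
Notation leb := (@lebesgue_measure R).
Implicit Types (m s a x : R) (f g : R -> R).

(** The Radon-Nikodym derivative of the normal law and [normal_pdf] have the same integral over
    every measurable set, hence agree almost everywhere. *)
Lemma ge0_integral_normal_prob m s (f : R -> \bar R) :
  measurable_fun [set: R] f -> (forall x, 0 <= f x)%E ->
  (\int[normal_prob m s]_x f x = \int[leb]_x (f x * (normal_pdf m s x)%:E))%E.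
Proof.
move=> mf f0; have dom := @normal_prob_dominates R m s.
pose rho := Radon_Nikodym_SigmaFinite.f (normal_prob m s) leb.
rewrite -(Radon_Nikodym_SigmaFinite.change_of_variables dom)//.
have irho : leb.-integrable setT rho.
  exact: Radon_Nikodym_SigmaFinite.f_integrable.
have mpdf : measurable_fun [set: R] (fun x => (normal_pdf m s x)%:E).
  by apply/measurable_EFinP; exact: measurable_normal_pdf.
apply: ae_eq_integral => //.
- by apply: emeasurable_funM => //; exact: measurable_int irho.
- exact: emeasurable_funM.
have : ae_eq leb setT rho (fun x => (normal_pdf m s x)%:E).
  apply: integral_ae_eq => // E _ mE.
  by rewrite -Radon_Nikodym_SigmaFinite.f_integral.
by apply: filterS => x /= h _; rewrite -/rho h.
Qed.

Lemma integrable_normal_probP m s f : measurable_fun [set: R] f ->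
  (normal_prob m s).-integrable [set: R] (EFin \o f) <->
  leb.-integrable [set: R] (EFin \o (fun x => f x * normal_pdf m s x)).
Proof.
move=> mf; have mpdf := @measurable_normal_pdf R m s.
have E : (\int[normal_prob m s]_x `|(f x)%:E| =
          \int[leb]_x `|(f x * normal_pdf m s x)%:E|)%E.
  rewrite ge0_integral_normal_prob//; last first.
    by apply: measurableT_comp => //; exact/measurable_EFinP.
  apply: eq_integral => x _.
  by rewrite EFinM abseM (gee0_abs (x := (normal_pdf m s x)%:E))// lee_fin normal_pdf_ge0.
split=> /integrableP[_ h]; apply/integrableP; split.
- by apply/measurable_EFinP/measurable_funM.
- by rewrite -E.
- exact/measurable_EFinP.
- by rewrite /comp E.
Qed.

Lemma Rintegral_normal_prob m s f :
  (normal_prob m s).-integrable [set: R] (EFin \o f) ->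
  \int[normal_prob m s]_x f x = \int[leb]_x (f x * normal_pdf m s x).
Proof.
move=> intf; have mf : measurable_fun [set: R] f.
  by move/integrableP : intf => [/measurable_EFinP].
rewrite /Rintegral; congr fine.
rewrite [LHS]integralE [RHS]integralE.
congr (_ - _)%E.
- rewrite ge0_integral_normal_prob//; last first.
    by apply: measurable_funepos; exact/measurable_EFinP.
  apply: eq_integral => x _; rewrite !funeposE/=.
  by rewrite -!EFin_max -EFinM maxr_pMl ?mul0r// normal_pdf_ge0.
- rewrite ge0_integral_normal_prob//; last first.
    by apply: measurable_funeneg; exact/measurable_EFinP.
  apply: eq_integral => x _; rewrite !funenegE/=.
  by rewrite -!EFin_max -EFinM maxr_pMl ?mul0r ?mulNr// normal_pdf_ge0.
Qed.

(** Completing the square: an exponential tilt of a normal density shifts its mean. *)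
Lemma normal_pdf_tilt m a x :
  normal_pdf m 1 x * expR (a * x) =
  expR (a * m + a ^+ 2 / 2) * normal_pdf (m + a) 1 x.
Proof.
rewrite !normal_pdfE ?oner_eq0// /normal_fun mulrCA -!mulrA; congr (_ * _).
rewrite -!expRD; congr expR.
by field.
Qed.

End normal_density.

(** * Stein's identity for one normal variable *)

Section normal_stein.
Context {R : realType}.
Notation leb := (@lebesgue_measure R).
Implicit Types (m s a x : R) (f g : R -> R).

Lemma sqr_weight_le_expR x :
  (1 + x ^+ 2) ^+ 2 <= 48 * (expR x + expR (- x)).
Proof.
suff H (y : R) : 0 <= y -> (1 + y ^+ 2) ^+ 2 <= 48 * expR y.
  have [x0|/ltW x0] := leP 0 x.
    by rewrite (le_trans (H _ x0))// ler_pM2l// lerDl expR_ge0.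
  rewrite -(sqrrN x) (le_trans (H (- x) _)) ?oppr_ge0//.
  by rewrite ler_pM2l// lerDr expR_ge0.
(* The constant 48 is twice [4!]: it turns the Taylor bound into [48 + 2 y^4], which exceeds
   [2 (1 + y^4) = (1 + y^2)^2 + (1 - y^2)^2]. *)
move=> y0; have := expR_ge1Dxn 3 y0; rewrite (_ : 4`! = 24)%N// => h.
have : 48 * (1 + y ^+ 4 / 24) <= 48 * expR y by rewrite ler_pM2l.
apply: le_trans; rewrite mulrDr mulr1 mulrCA.
have -> : 48 / 24 = 2 :> R by field.
have : 0 <= (1 - y ^+ 2) ^+ 2 by exact: sqr_ge0.
by move=> ?; nra.
Qed.

(** The weight is dominated by [expR x + expR (- x)], and these exponentials tilt the density to the
    means [m + 1] and [m - 1]. Integrability of polynomials thus reduces to that of normal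
    densities. *)
Lemma normal_pdf_weight m : exists2 C : R, 0 <= C & forall x,
  (1 + x ^+ 2) ^+ 2 * normal_pdf m 1 x <=
  C * (normal_pdf (m + 1) 1 x + normal_pdf (m - 1) 1 x).
Proof.
exists (48 * (expR (m + 2^-1) + expR (- m + 2^-1))).
  by rewrite mulr_ge0// addr_ge0// expR_ge0.
move=> x; have p0 := normal_pdf_ge0 m 1 x.
apply: (le_trans (ler_wpM2r p0 (sqr_weight_le_expR x))).
have t1 := normal_pdf_tilt m 1 x; have t2 := normal_pdf_tilt m (-1) x.
rewrite !(mul1r, mulN1r, expr1n, sqrrN) in t1 t2.
have -> : 48 * (expR x + expR (- x)) * normal_pdf m 1 x =
    48 * (normal_pdf m 1 x * expR x + normal_pdf m 1 x * expR (- x)) by ring.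
rewrite t1 t2 -[leRHS]mulrA ler_pM2l//.
set A := expR _; set B := expR (- m + _).
have A0 : 0 <= A by exact: expR_ge0.
have B0 : 0 <= B by exact: expR_ge0.
have p1 := normal_pdf_ge0 (m + 1) 1 x.
have p2 := normal_pdf_ge0 (m - 1) 1 x.
have h1 := mulr_ge0 A0 p2; have h2 := mulr_ge0 B0 p1.
by rewrite mulrDl !mulrDr; lra.
Qed.

Lemma integrable_sqr_weight m : (normal_prob m 1).-integrable [set: R]
  (EFin \o (fun x => (1 + x ^+ 2) ^+ 2)).
Proof.
have mw : measurable_fun [set: R] (fun x => (1 + x ^+ 2) ^+ 2 : R).
  by apply: (measurable_funX 2); apply: measurable_funD.
apply/integrable_normal_probP => //.
have [C C0 hC] := normal_pdf_weight m.
apply: (@integrable_le _ _ _ leb _ (fun x =>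
   C * (normal_pdf (m + 1) 1 x + normal_pdf (m - 1) 1 x))).
- by apply: measurable_funM => //; exact: measurable_normal_pdf.
- move=> x; rewrite ger0_norm//; apply: mulr_ge0; rewrite ?normal_pdf_ge0//.
  exact: sqr_ge0.
- apply: (integrable_EFinZl (mu := leb)).
  by apply: (integrable_EFinD (mu := leb)); exact: integrable_normal_pdf.
Qed.

(** Provides the decay that makes the boundary terms of an integration by parts vanish. *)
Lemma normal_pdf_weight_bounded m K (F : R -> R) :
  (forall x, `|F x| <= K * (1 + x ^+ 2) * normal_pdf m 1 x) ->
  exists C, forall x, `|F x| * (1 + x ^+ 2) <= C.
Proof.
have [C C0 hC] := normal_pdf_weight m => FK.
exists (`|K| * (C * (normal_peak 1 + normal_peak 1))) => x.
have w0 : 0 < 1 + x ^+ 2 by rewrite ltr_wpDr ?sqr_ge0.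
apply: (@le_trans _ _ (`|K| * ((1 + x ^+ 2) ^+ 2 * normal_pdf m 1 x))).
  rewrite [leRHS](_ : _ = `|K| * (1 + x ^+ 2) * normal_pdf m 1 x * (1 + x ^+ 2));
    last by ring.
  rewrite ler_pM2r// (le_trans (FK x))// ler_wpM2r ?normal_pdf_ge0//.
  by rewrite ler_pM2r// ler_norm.
apply: ler_wpM2l => //; apply: (le_trans (hC x)).
by apply: ler_wpM2l => //; apply: lerD; apply: normal_pdf_ub; exact: oner_neq0.
Qed.

Lemma is_derive_normal_pdf m x :
  is_derive x 1 (normal_pdf m 1) (- (x - m) * normal_pdf m 1 x).
Proof.
rewrite normal_pdfE ?oner_eq0// /normal_fun.
apply: is_derive_eq.
by rewrite /GRing.scale/=; field.
Qed.

Lemma derivable_continuous (g g' : R -> R) :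
  (forall x, is_derive x 1 g (g' x)) -> continuous g.
Proof.
move=> dg x; apply/differentiable_continuous/derivable1_diffP.
exact: (@ex_derive _ _ _ _ _ _ _ (dg x)).
Qed.

Lemma Rintegral_FTC2 (F f : R -> R) a b : a < b -> continuous f ->
  (forall x, is_derive x 1 F (f x)) ->
  \int[leb]_(x in `[a, b]) f x = F b - F a.
Proof.
move=> ab cf dF; have cF := derivable_continuous dF.
rewrite /Rintegral (continuous_FTC2 ab (F := F))//.
- exact: continuous_subspaceT.
- split.
  + by move=> x _; exact: (@ex_derive _ _ _ _ _ _ _ (dF x)).
  + exact/cvg_at_right_filter/cF.
  + exact/cvg_at_left_filter/cF.
- by move=> x _; rewrite derive1E; exact: (@derive_val _ _ _ _ _ _ _ (dF x)).
Qed.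

Lemma cvg_Rintegral_itv_sym (f : R -> R) :
  leb.-integrable [set: R] (EFin \o f) ->
  \int[leb]_(x in `[- n.+1%:R, n.+1%:R]) f x @[n --> \oo] -->
  \int[leb]_x f x.
Proof.
move=> intf; have mf : measurable_fun [set: R] f.
  by move/integrableP : (intf) => [/measurable_EFinP].
under eq_fun do rewrite Rintegral_mkcond.
apply: (Rintegral_dominated_cvg (mu := leb) (g := fun x => `|f x|)).
- by move=> n; apply/(measurable_restrictT _ _).1 => //; exact: measurable_funTS.
- move=> x; apply: cvg_near_cst; near=> n; rewrite patchT// inE/= in_itv/=.
  rewrite -ler_norml (@le_trans _ _ n%:R)//; last by rewrite ler_nat.
  by near: n; exact: nbhs_infty_ger.
- exact: (integrable_norm (mu := leb)).
- by move=> n x; rewrite /patch; case: ifPn => // _; rewrite normr0.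
Unshelve. all: by end_near. Qed.

(** By the fundamental theorem the integral over [[-n, n]] is [F n - F (-n)], which tends to 0 by
    the decay of [F]. *)
Lemma Rintegral_derive0 (F f : R -> R) C : continuous f ->
  (forall x, is_derive x 1 F (f x)) ->
  leb.-integrable [set: R] (EFin \o f) ->
  (forall x, `|F x| * (1 + x ^+ 2) <= C) -> \int[leb]_x f x = 0.
Proof.
move=> cf dF intf FC; have h := cvg_Rintegral_itv_sym intf.
have N0 n : - n.+1%:R < n.+1%:R :> R by rewrite gtrN.
have C0 : 0 <= C.
  by apply: le_trans (FC 0); rewrite mulr_ge0// addr_ge0// sqr_ge0.
(* As [n.+1 <= 1 + n.+1 ^ 2], the weighted bound gives decay of order [1 / n.+1] at both
   endpoints. *)
have Fn n (y : R) : y ^+ 2 = n.+1%:R ^+ 2 -> `|F y| <= C / n.+1%:R.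
  move=> yn; rewrite ler_pdivlMr// (le_trans _ (FC y))// ler_wpM2l// yn.
  have : 1 <= n.+1%:R :> R by rewrite ler1n.
  by move: (n.+1%:R : R) => u u1; nra.
suff : \int[leb]_(x in `[- n.+1%:R, n.+1%:R]) f x @[n --> \oo] --> (0 : R).
  by move=> h0; exact: (cvg_unique _ h h0).
apply: norm_cvg0.
apply: (@squeeze_cvgr _ _ _ _ (cst 0) (fun n => 2 * C * n.+1%:R^-1)).
- apply: nearW => n; rewrite normr_ge0/= (Rintegral_FTC2 (N0 n) cf dF).
  rewrite (le_trans (ler_normB _ _))// -mulrA mulr_natl mulr2n.
  by apply: lerD; apply: Fn; rewrite ?sqrrN.
- exact: cvg_cst.
- rewrite -[X in _ --> X](mulr0 (2 * C)).
  by apply: cvgM; [exact: cvg_cst|exact: cvg_harmonic].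
Qed.

Lemma stein_integrand_le m K x u v :
  `|u| <= K * (1 + x ^+ 2) -> `|v| <= K * (1 + x ^+ 2) ->
  `|(x - m) * u - v| <= K * (2 + `|m|) * (1 + x ^+ 2) ^+ 2.
Proof.
move=> uK vK; have w1 : 1 <= 1 + x ^+ 2 by rewrite lerDl sqr_ge0.
rewrite (le_trans (ler_normB _ _))// normrM.
have xm : `|x - m| <= (1 + `|m|) * (1 + x ^+ 2).
  rewrite (le_trans (ler_normB _ _))//.
  have : `|x| <= 1 + x ^+ 2.
    rewrite -real_normK ?num_real//; have := normr_ge0 x.
    by move: `|x| => y y0; nra.
  by have := normr_ge0 m; nra.
have h1 := ler_pM (normr_ge0 _) (normr_ge0 _) xm uK.
have h2 : `|v| <= K * (1 + x ^+ 2) ^+ 2.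
  rewrite (le_trans vK)// expr2 mulrA ler_peMr//.
  exact: le_trans (normr_ge0 _) vK.
have -> : K * (2 + `|m|) * (1 + x ^+ 2) ^+ 2 =
  (1 + `|m|) * (1 + x ^+ 2) * (K * (1 + x ^+ 2)) + K * (1 + x ^+ 2) ^+ 2.
  by ring.
exact: lerD.
Qed.

(** Integration by parts: the density has derivative [- (x - m)] times itself, so minus the
    integrand times the density is the derivative of [g * normal_pdf m 1], which vanishes at
    infinity. *)
Lemma normal_stein m K (g g' : R -> R) :
  (forall x, is_derive x 1 g (g' x)) -> continuous g' ->
  (forall x, `|g x| <= K * (1 + x ^+ 2)) ->
  (forall x, `|g' x| <= K * (1 + x ^+ 2)) ->
  \int[normal_prob m 1]_x ((x - m) * g x - g' x) = 0.
Proof.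
move=> dg cg' gK g'K; have cg := derivable_continuous dg.
set k := fun x => (x - m) * g x - g' x.
have ck : continuous k.
  move=> x; apply: cvgB; last exact: cg'.
  apply: cvgM; last exact: cg.
  by apply: cvgB; [exact: cvg_id|exact: cvg_cst].
have intk : (normal_prob m 1).-integrable [set: R] (EFin \o k).
  apply: (integrable_le (mu := normal_prob m 1)
    (g := fun x => K * (2 + `|m|) * (1 + x ^+ 2) ^+ 2)).
  - exact: continuous_measurable_fun.
  - by move=> x; exact: stein_integrand_le.
  - by apply: (integrable_EFinZl (mu := normal_prob m 1)); exact: integrable_sqr_weight.
rewrite Rintegral_normal_prob//; apply/eqP; rewrite -oppr_eq0; apply/eqP.
have intkp := (integrable_normal_probP m 1
  (continuous_measurable_fun ck)).1 intk.
rewrite -mulN1r -RintegralZl//.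
have [|C FC] := @normal_pdf_weight_bounded m K (fun x => g x * normal_pdf m 1 x).
  move=> x; rewrite normrM (ger0_norm (normal_pdf_ge0 _ _ _)).
  by rewrite ler_wpM2r// normal_pdf_ge0.
apply: (@Rintegral_derive0 (fun x => g x * normal_pdf m 1 x) _ C) => //.
- move=> x; apply: cvgM; first exact: cvg_cst.
  by apply: cvgM; [exact: ck|apply: continuous_normal_pdf; exact: oner_neq0].
- move=> x; have := is_derive_normal_pdf m x => dp.
  apply: is_derive_eq; rewrite /GRing.scale/= /k.
  by ring.
- exact: (integrable_EFinZl (mu := leb)).
Qed.

End normal_stein.

(** * Stein's identities for a product of independent normals *)

Section independent_normals.
Context d (T : measurableType d) (R : realType) (P : probability T R).
Variables (X Y : {RV P >-> R}) (muX muY : R).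
Hypotheses (hX : has_law X (normal_prob muX 1)) (hY : has_law Y (normal_prob muY 1)).
Hypothesis hXY : independent_RV X Y.

(* [normal_prob] lives on [measurableTypeR R], whose sigma-algebra is that of
   [R] but whose display differs; the joint law is therefore built there. *)
Let GR : measurableType _ := measurableTypeR R.

Let N2 := (normal_prob muX 1 \x normal_prob muY 1)%E.

Let XY (t : T) : GR * GR := (X t, Y t).

Let mXY : measurable_fun [set: T] XY.
Proof.
apply/measurable_fun_pairP; split.
  exact: (measurable_funPT X).
exact: (measurable_funPT Y).
Qed.

(** Independence gives agreement on measurable rectangles, which determine the product measure. *)
Let joint_law (A : set (GR * GR)) : measurable A -> N2 A = pushforward P XY A.
Proof.
pose XYm : {mfun T >-> (GR * GR)%type} := mfun_Sub (mem_set mXY).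
apply: (product_measure_unique (m' := distribution P XYm)) => B C mB mC.
transitivity (distribution P X B * distribution P Y C)%E.
  by rewrite -(hXY mB mC).
by congr (_ * _)%E; [exact: hX|exact: hY].
Qed.

Let integrable_joint (k : GR * GR -> R) : measurable_fun [set: GR * GR] k ->
  N2.-integrable [set: GR * GR] (EFin \o k) ->
  P.-integrable [set: T] (EFin \o (fun t => k (X t, Y t))) /\
  \int[P]_t k (X t, Y t) = \int[N2]_p k p.
Proof.
move=> mk /integrableP[_ ik].
have mkXY : measurable_fun [set: T] (fun t => k (X t, Y t)).
  exact: (measurableT_comp mk mXY).
have intk : P.-integrable [set: T] (EFin \o (fun t => k (X t, Y t))).
  apply/integrableP; split; first exact/measurable_EFinP.
  rewrite -(ge0_integral_pushforward mXY P (D := setT)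
    (f := fun p => `|(k p)%:E|%E))//; last first.
    by apply: measurableT_comp => //; exact/measurable_EFinP.
  rewrite -(eq_measure_integral (pushforward P XY) (m1 := N2))//.
  by move=> A mA _; exact: joint_law.
split=> //; rewrite /Rintegral; congr fine.
rewrite (eq_measure_integral (pushforward P XY) (m1 := N2)); last first.
  by move=> A mA _; exact: joint_law.
rewrite (integral_pushforward mXY)//.
exact/measurable_EFinP.
Qed.

(** Test functions will grow at most like [w x * w y]. The factor [Y - muY] of Stein's identity
    raises this to squares, whose integral against the product law factors. *)
Let w (x : R) := 1 + x ^+ 2.

Let w_ge1 x : 1 <= w x. Proof. by rewrite lerDl sqr_ge0. Qed.

Let w_ge0 x : 0 <= w x. Proof. exact: le_trans (w_ge1 x). Qed.

Let mw2 : measurable_fun [set: GR] (fun x : GR => w x ^+ 2).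
Proof. by apply: (measurable_funX 2); apply: measurable_funD. Qed.

Let integrable_weight (K : R) : N2.-integrable [set: GR * GR]
  (EFin \o (fun p : GR * GR => K * (w p.1 ^+ 2 * w p.2 ^+ 2))).
Proof.
apply: (integrable_EFinZl (mu := N2)).
have m2 : measurable_fun [set: GR * GR]
    (fun p : GR * GR => w p.1 ^+ 2 * w p.2 ^+ 2).
  by apply: measurable_funM;
    [exact: (measurableT_comp mw2 measurable_fst)|
     exact: (measurableT_comp mw2 measurable_snd)].
apply/(@integrable12ltyP _ _ _ _ R (normal_prob muX 1) (normal_prob muY 1)).
  exact/measurable_EFinP.
have i1 := integrable_sqr_weight muX; have i2 := integrable_sqr_weight muY.
under eq_integral.
  move=> x _.
  have -> : (\int[normal_prob muY 1]_y `|(w x ^+ 2 * w y ^+ 2)%:E| =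
    (w x ^+ 2)%:E * \int[normal_prob muY 1]_y (w y ^+ 2)%:E)%E.
    rewrite -(integralZl (mu := normal_prob muY 1) measurableT i2).
    apply: eq_integral => y _; rewrite -EFinM gee0_abs// lee_fin.
    by rewrite mulr_ge0// sqr_ge0.
  over.
have f2 := integrable_fin_num (mu := normal_prob muY 1) measurableT i2.
rewrite -(fineK f2) (integralZr (mu := normal_prob muX 1) measurableT i1).
have f1 := integrable_fin_num (mu := normal_prob muX 1) measurableT i1.
by rewrite -(fineK f1) -EFinM ltry.
Qed.

Lemma integrable_mul : P.-integrable [set: T] (EFin \o (fun t => X t * Y t)).
Proof.
have mk : measurable_fun [set: GR * GR] (fun p : GR * GR => p.1 * p.2 : R).
  by apply: measurable_funM; [exact: measurable_fst|exact: measurable_snd].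
apply: (integrable_joint mk _).1.
apply: (integrable_le (mu := N2) mk _ (integrable_weight 1)) => -[x y] /=.
have le_w z : `|z| <= w z ^+ 2.
  rewrite /w -(real_normK (num_real z)); move: `|z| => u.
  by have := sqr_ge0 (u ^+ 2); have := sqr_ge0 (u - 1); nra.
by rewrite normrM mul1r ler_pM.
Qed.

(** By Fubini the expectation is an iterated integral; for each fixed [x] the inner one vanishes by
    [normal_stein], applied with the constant [K * w x]. *)
Lemma stein_pair (K : R) (h h' : R -> R -> R) :
  measurable_fun [set: GR * GR] (fun p : GR * GR => h p.1 p.2) ->
  measurable_fun [set: GR * GR] (fun p : GR * GR => h' p.1 p.2) ->
  (forall x y : R, is_derive y 1 (h x) (h' x y)) ->
  (forall x, continuous (h' x)) ->
  (forall x y, `|h x y| <= K * w x * w y) ->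
  (forall x y, `|h' x y| <= K * w x * w y) ->
  mean0 P (fun t => (Y t - muY) * h (X t) (Y t) - h' (X t) (Y t)).
Proof.
move=> mh mh' dh ch' hK h'K.
pose k x y := (y - muY) * h x y - h' x y.
have kK x y : `|k x y| <= K * w x * (2 + `|muY|) * w y ^+ 2.
  by apply: stein_integrand_le; [exact: hK|exact: h'K].
have mk : measurable_fun [set: GR * GR] (fun p : GR * GR => k p.1 p.2).
  apply: measurable_funB => //; apply: measurable_funM => //.
  by apply: measurable_funB => //; exact: measurable_snd.
have ik : N2.-integrable [set: GR * GR] (EFin \o (fun p : GR * GR => k p.1 p.2)).
  apply: (integrable_le (mu := N2) mk _ (integrable_weight (`|K| * (2 + `|muY|)))).
  move=> -[x y] /=; rewrite (le_trans (kK x y))//.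
  have wy : 0 <= (2 + `|muY|) * w y ^+ 2 by rewrite mulr_ge0 ?addr_ge0 ?sqr_ge0.
  have wx : w x <= w x ^+ 2 by rewrite expr2 ler_peMr.
  have -> : `|K| * (2 + `|muY|) * (w x ^+ 2 * w y ^+ 2) =
    `|K| * w x ^+ 2 * ((2 + `|muY|) * w y ^+ 2) by ring.
  rewrite -[leLHS]mulrA ler_wpM2r// (le_trans (ler_wpM2r (w_ge0 x) (ler_norm K)))//.
  by rewrite ler_wpM2l.
have [iP eP] := integrable_joint mk ik; split; first exact: iP.
rewrite -[LHS]/(\int[P]_t (fun p : GR * GR => k p.1 p.2) (X t, Y t)).
rewrite eP /Rintegral.
rewrite -(@integral12_prod_meas1 _ _ _ _ R (normal_prob muX 1) (normal_prob muY 1) _ ik).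
rewrite (eq_integral (cst 0%E)) ?integral0// => x _ /=.
have ck : continuous (k x).
  move=> y; apply: cvgB; last exact: ch'.
  apply: cvgM; last exact: (derivable_continuous (dh x)).
  by apply: cvgB; [exact: cvg_id|exact: cvg_cst].
have ikx : (normal_prob muY 1).-integrable [set: R] (EFin \o k x).
  apply: (integrable_le (mu := normal_prob muY 1)
    (g := fun y => K * w x * (2 + `|muY|) * w y ^+ 2)).
  - exact: continuous_measurable_fun.
  - exact: kK.
  - apply: (integrable_EFinZl (mu := normal_prob muY 1)).
    exact: integrable_sqr_weight.
have := normal_stein muY (dh x) (ch' x) (hK x) (h'K x).
rewrite /Rintegral => s0; rewrite /fubini_F/= -[LHS]fineK.
  by rewrite s0.
exact: (integrable_fin_num (mu := normal_prob muY 1)).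
Qed.

(** * Test functions of the product [x * y] *)

Section test_function.
Variables (B : R) (g g' : R -> R).
Hypothesis dg : forall x : R, is_derive x 1 g (g' x).
Hypothesis cg' : continuous g'.
Hypothesis gB : forall x, `|g x| <= B.
Hypothesis g'B : forall x, `|g' x| <= B.

Let B0 : 0 <= B. Proof. exact: le_trans (normr_ge0 _) (gB 0). Qed.

Let cg : continuous g. Proof. exact: derivable_continuous dg. Qed.

Let measurable_comp_mul (u : R -> R) : continuous u ->
  measurable_fun [set: GR * GR] (fun p : GR * GR => u (p.1 * p.2)).
Proof.
move=> cu; have mM : measurable_fun [set: GR * GR] (fun p : GR * GR => p.1 * p.2 : R).
  by apply: measurable_funM; [exact: measurable_fst|exact: measurable_snd].
exact: (measurableT_comp (continuous_measurable_fun cu) mM).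
Qed.

Let mg := measurable_comp_mul cg.
Let mg' := measurable_comp_mul cg'.

Let is_derive_mul (x y : R) :
  is_derive y 1 (fun y => g (x * y)) (x * g' (x * y)).
Proof.
have dM : is_derive y 1 (fun y : R => x * y) x.
  by apply: is_derive_eq; rewrite /GRing.scale/=; ring.
have dgM : is_derive (x * y) 1 g (g' (x * y)) by exact: dg.
have := is_derive1_comp (f := g) (g := fun y => x * y).
by move=> /(_ _ _ _ dgM dM); rewrite mulrC.
Qed.

Let weight_mul (x y : R) : 1 + `|x * y| <= w x * w y.
Proof.
rewrite /w normrM -(real_normK (num_real x)) -(real_normK (num_real y)).
by move: `|x| `|y| => u v; have := sqr_ge0 (u - v); have := sqr_ge0 (u * v); nra.
Qed.

Let weight_fst (x y : R) : `|x| <= w x * w y.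
Proof.
apply: (@le_trans _ _ (w x)); last by rewrite ler_peMr.
rewrite /w -(real_normK (num_real x)).
by move: `|x| => u; have := sqr_ge0 (u - 1); nra.
Qed.

Lemma stein_mul :
  mean0 P (fun t => (Y t - muY) * g (X t * Y t) - X t * g' (X t * Y t)).
Proof.
apply: (@stein_pair B (fun x y => g (x * y)) (fun x y => x * g' (x * y))).
- exact: mg.
- by apply: measurable_funM mg'; exact: measurable_fst.
- by move=> x y; exact: is_derive_mul.
- move=> x y; apply: cvgM; first exact: cvg_cst.
  apply: (cvg_comp (fun y => x * y) g'); last exact: cg'.
  by apply: cvgM; [exact: cvg_cst|exact: cvg_id].
- by move=> x y; rewrite -mulrA (le_trans (gB _))// ler_peMr// mulr_ege1.
- move=> x y; rewrite -mulrA normrM mulrC ler_pM//.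
Qed.

Lemma stein_mul_fst : mean0 P (fun t =>
  (Y t - muY) * (X t * g (X t * Y t)) - X t ^+ 2 * g' (X t * Y t)).
Proof.
apply: (@stein_pair B (fun x y => x * g (x * y)) (fun x y => x ^+ 2 * g' (x * y))).
- by apply: measurable_funM mg; exact: measurable_fst.
- apply: measurable_funM mg'.
  by apply: (measurable_funX 2); exact: measurable_fst.
- move=> x y; have dM := is_derive_mul x y.
  by apply: is_derive_eq; rewrite /GRing.scale/=; ring.
- move=> x y; apply: cvgM; first exact: cvg_cst.
  apply: (cvg_comp (fun y => x * y) g'); last exact: cg'.
  by apply: cvgM; [exact: cvg_cst|exact: cvg_id].
- by move=> x y; rewrite -mulrA normrM mulrC ler_pM.
- move=> x y; rewrite -mulrA normrM mulrC ler_pM// normrX.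
  rewrite real_normK ?num_real// (@le_trans _ _ (w x))//.
    by rewrite lerDr.
  by rewrite ler_peMr.
Qed.

Lemma stein_mul_snd : mean0 P (fun t =>
  (Y t - muY) * (Y t * g (X t * Y t)) -
  (g (X t * Y t) + X t * Y t * g' (X t * Y t))).
Proof.
apply: (@stein_pair B (fun x y => y * g (x * y))
  (fun x y => g (x * y) + x * y * g' (x * y))).
- by apply: measurable_funM mg; exact: measurable_snd.
- apply: measurable_funD => //; apply: measurable_funM mg'.
  by apply: measurable_funM; [exact: measurable_fst|exact: measurable_snd].
- move=> x y; have dM := is_derive_mul x y.
  by apply: is_derive_eq; rewrite /GRing.scale/=; ring.
- move=> x y.
  have cM : (fun y => x * y) z @[z --> y] --> x * y.
    by apply: cvgM; [exact: cvg_cst|exact: cvg_id].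
  apply: cvgD; first by apply: (cvg_comp (fun y => x * y) g) cM _; exact: cg.
  by apply: cvgM => //; apply: (cvg_comp (fun y => x * y) g') cM _; exact: cg'.
- by move=> x y; rewrite -mulrA normrM mulrC ler_pM// mulrC.
- move=> x y; rewrite -[leRHS]mulrA (le_trans (ler_normD _ _))// normrM.
  rewrite (le_trans _ (ler_wpM2l B0 (weight_mul x y)))// mulrDr mulr1 lerD//.
  by rewrite mulrC ler_wpM2r.
Qed.

End test_function.

End independent_normals.

(** * Jets and cutoffs *)

Section jets.
Context {R : realType}.
Implicit Types (F G : nat -> R -> R) (k n : nat).

(** A function together with its derivatives: [F k] stands for the [k]-th derivative of [F 0].
    Derivatives are then given by explicit formulas instead of iterated [derive1n]. *)
Definition jet n F :=
  (forall k (x : R), (k < n)%N -> is_derive x 1 (F k) (F k.+1 x)) /\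
  (forall k, (k <= n)%N -> continuous (F k)).

Definition jet_shift F k := F k.+1.

Lemma jetS n F : jet n.+1 F -> jet n F.
Proof.
move=> [dF cF]; split=> [k x kn|k kn]; first by apply: dF; exact: ltnW.
by apply: cF; exact: leqW.
Qed.

Lemma jet_shiftP n F : jet n.+1 F -> jet n (jet_shift F).
Proof. by move=> [dF cF]; split=> [k x kn|k kn]; [exact: dF|exact: cF]. Qed.

Lemma jet_leq m n F : (m <= n)%N -> jet n F -> jet m F.
Proof.
move=> mn [dF cF]; split=> [k x km|k km].
  by apply: dF; exact: leq_trans mn.
by apply: cF; exact: leq_trans mn.
Qed.

(* Leibniz rule for jets, without binomial coefficients. *)
Fixpoint jet_mul F G k (x : R) : R :=
  if k is k'.+1 then jet_mul (jet_shift F) G k' x + jet_mul F (jet_shift G) k' x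
  else F 0%N x * G 0%N x.

Lemma is_derive_jet_mul k F G (x : R) : jet k.+1 F -> jet k.+1 G ->
  is_derive x 1 (jet_mul F G k) (jet_mul F G k.+1 x).
Proof.
elim: k F G => [|k IH] F G jF jG.
  have dF : is_derive x 1 (F 0%N) (F 1%N x) by exact: jF.1.
  have dG : is_derive x 1 (G 0%N) (G 1%N x) by exact: jG.1.
  by apply: is_derive_eq; rewrite /GRing.scale/=/jet_shift; ring.
have d1 := IH _ _ (jet_shiftP jF) (jetS jG).
have d2 := IH _ _ (jetS jF) (jet_shiftP jG).
exact: is_deriveD.
Qed.

Lemma continuous_jet_mul k F G : jet k F -> jet k G ->
  continuous (jet_mul F G k).
Proof.
elim: k F G => [|k IH] F G jF jG x.
  by apply: cvgM; [exact: jF.2|exact: jG.2].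
apply: cvgD; first exact: (IH _ _ (jet_shiftP jF) (jetS jG)).
exact: (IH _ _ (jetS jF) (jet_shiftP jG)).
Qed.

Lemma jet_jet_mul n F G : jet n F -> jet n G -> jet n (jet_mul F G).
Proof.
move=> jF jG; split=> [k x kn|k kn].
  by apply: is_derive_jet_mul; exact: jet_leq kn _.
by apply: continuous_jet_mul; exact: jet_leq kn _.
Qed.

Lemma jet_mul_eq0l k F G x :
  (forall j, (j <= k)%N -> F j x = 0) -> jet_mul F G k x = 0.
Proof.
elim: k F G => [|k IH] F G F0 /=; first by rewrite F0// mul0r.
by rewrite !IH ?addr0// => j jk; apply: F0 => //; exact: leqW.
Qed.

Lemma jet_mul_eq0r k F G x :
  (forall j, (j <= k)%N -> G j x = 0) -> jet_mul F G k x = 0.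
Proof.
elim: k F G => [|k IH] F G G0 /=; first by rewrite G0// mulr0.
by rewrite !IH ?addr0// => j jk; apply: G0 => //; exact: leqW.
Qed.

(** The jet of the constant function 1, to which the cutoffs converge. *)
Definition jet1 k (x : R) : R := (k == 0)%:R.

Lemma jet_mul1 k F x : jet_mul F jet1 k x = F k x.
Proof.
elim: k F => [|k IH] F /=; first by rewrite mulr1.
by rewrite IH jet_mul_eq0r ?addr0.
Qed.

(** The majorant depends on [G] only through the bound [B], so it will dominate the products with
    all cutoffs at once. *)
Lemma le_jet_mul k F G B x :
  (forall j, (j <= k)%N -> `|G j x| <= B) ->
  `|jet_mul F G k x| <= jet_mul (fun j y => `|F j y|) (fun _ _ => B) k x.
Proof.
elim: k F G => [|k IH] F G GB /=; first by rewrite normrM ler_wpM2l// GB.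
rewrite (le_trans (ler_normD _ _))// lerD//.
  by apply: IH => j jk; apply: GB; exact: leqW.
by apply: IH => j jk; exact: GB.
Qed.

Lemma cvg_jet_mul k (F_ G_ : nat -> nat -> R -> R) F G x :
  (forall j, (j <= k)%N -> F_ m j x @[m --> \oo] --> F j x) ->
  (forall j, (j <= k)%N -> G_ m j x @[m --> \oo] --> G j x) ->
  jet_mul (F_ m) (G_ m) k x @[m --> \oo] --> jet_mul F G k x.
Proof.
elim: k F_ G_ F G => [|k IH] F_ G_ F G F_F G_G /=.
  by apply: cvgM; [exact: F_F|exact: G_G].
apply: cvgD.
  apply: (IH (fun m => jet_shift (F_ m)) G_ (jet_shift F)) => j jk.
    exact: F_F.
  by apply: G_G; exact: leqW.
apply: (IH F_ (fun m => jet_shift (G_ m)) F (jet_shift G)) => j jk.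
  by apply: F_F; exact: leqW.
exact: G_G.
Qed.

End jets.

(** * Compactly supported polynomial cutoffs *)

Section cutoff.
Context {R : realType}.
Implicit Types (k j m n : nat) (x u s : R).

Lemma continuous_pos_part_exp k : continuous (fun v : R => Num.max v 0 ^+ k).
Proof.
move=> x; apply: (cvg_comp (fun v => Num.max v 0) (fun v => v ^+ k)).
  by apply: (@continuous_max _ _ id (cst 0)); [exact: cvg_id|exact: cvg_cst].
exact: exprn_continuous.
Qed.

(** Away from 0 the function is locally 0 or a power. At 0 the difference quotient is at most [|h|]
    in absolute value for [|h| <= 1], the exponent being at least 2. *)
Lemma is_derive_pos_part_exp k u :
  is_derive u 1 (fun v => Num.max v 0 ^+ k.+2) (k.+2%:R * Num.max u 0 ^+ k.+1).
Proof.
have [u0|u0|->] := ltgtP u 0.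
- rewrite expr0n/= mulr0; apply: near_eq_is_derive (is_derive_cst 0 _ _).
  by near=> v; rewrite max_r ?expr0n// ltW//; near: v; exact: lt_nbhsl.
- apply: (@near_eq_is_derive _ _ _ (fun v : R => v ^+ k.+2)).
    by near=> v; rewrite max_l// ltW//; near: v; exact: lt_nbhsr.
  have := is_deriveX k.+2 (is_derive_id u (1 : R)).
  by rewrite /GRing.scale/= mulr1 exprfctE.
- have c0 : h^-1 *: (Num.max (h *: (1 : R) + 0) 0 ^+ k.+2 - Num.max 0 0 ^+ k.+2)
      @[h --> (0 : R)^'] --> (0 : R).
    apply/cvgrPdist_le => e e0; near=> h.
    have h0 : h != 0 by near: h; exact: nbhs_dnbhs_neq.
    have h1 : `|h| <= 1 by near: h; apply: dnbhs0_le.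
    rewrite sub0r normrN addr0 /GRing.scale/= mulr1 maxxx expr0n subr0.
    apply: (@le_trans _ _ `|h|); last by near: h; exact: dnbhs0_le.
    rewrite normrM normfV ler_pdivrMl ?normr_gt0// normrX.
    have le_h : `|Num.max h 0| <= `|h| by case: (leP h 0); rewrite ?normr0.
    rewrite (le_trans (lerXn2r _ _ _ le_h)) ?nnegrE// exprS.
    by rewrite ler_wpM2l// exprS ler_piMr// exprn_ile1.
  rewrite expr0n/= mulr0; apply: DeriveDef.
    by apply/cvg_ex; exists 0.
  exact: cvg_lim c0.
Unshelve. all: by end_near. Qed.

(** The [j]-th derivative of the fifth power of the positive part of [1 + s * x]; the power 5 leaves
    continuous derivatives up to order 4, the highest order in the theorem. *)
Definition ramp s j x : R :=
  s ^+ j * (5 ^_ j)%:R * Num.max (1 + s * x) 0 ^+ (5 - j).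

Lemma jet_ramp s : jet 4 (ramp s).
Proof.
split=> [k x k4|k k4 x]; rewrite /ramp.
  (* For [k < 4] the exponent [5 - k] is at least 2, as [is_derive_pos_part_exp] requires. *)
  have k5 : (5 - k = (3 - k).+2)%N by rewrite -!subSn// ltnW// ltnW.
  have dl : is_derive x 1 (fun x => 1 + s * x) s.
    by apply: is_derive_eq; rewrite /GRing.scale/=; ring.
  have dp := is_derive_pos_part_exp (3 - k) (1 + s * x).
  have := is_derive1_comp (f := fun v => Num.max v 0 ^+ (3 - k).+2)
    (g := fun y => 1 + s * y).
  move=> /(_ _ _ _ dp dl) dc.
  rewrite ffactnSr subnS k5 natrM exprSr; apply: is_derive_eq.
  by rewrite /GRing.scale/=; ring.
apply: cvgM; first exact: cvg_cst.
apply: (cvg_comp (fun y => 1 + s * y) (fun v => Num.max v 0 ^+ (5 - k))).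
  by apply: cvgD; [|apply: cvgM; [|exact: cvg_id]]; exact: cvg_cst.
exact: continuous_pos_part_exp.
Qed.

Definition cutoff m : nat -> R -> R :=
  jet_mul (ramp m.+1%:R^-1) (ramp (- m.+1%:R^-1)).

Lemma jet_cutoff m : jet 4 (cutoff m).
Proof. by apply: jet_jet_mul; exact: jet_ramp. Qed.

Lemma ramp_eq0 s j x : (j <= 4)%N -> 1 + s * x <= 0 -> ramp s j x = 0.
Proof.
(* For [j <= 4] the exponent [5 - j] is positive, so the power of 0 is 0 and not 1. *)
by move=> j4 sx; rewrite /ramp (max_r sx) expr0n subn_eq0 leqNgt ltnS j4 mulr0.
Qed.

Lemma cutoff_eq0 m j x : (j <= 4)%N -> m.+1%:R <= `|x| -> cutoff m j x = 0.
Proof.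
move=> j4 mx; have m0 : 0 < m.+1%:R :> R by rewrite ltr0n.
have [x0|/ltW x0] := leP 0 x.
  rewrite ger0_norm// in mx.
  apply: jet_mul_eq0r => i ij; apply: ramp_eq0; first exact: leq_trans j4.
  by rewrite mulNr subr_le0 ler_pdivlMl// mulr1.
rewrite ler0_norm// in mx.
apply: jet_mul_eq0l => i ij; apply: ramp_eq0; first exact: leq_trans j4.
by rewrite -lerBrDl sub0r ler_pdivrMl// mulrN1 lerNr.
Qed.

Lemma le_ramp s j x : (j <= 4)%N -> `|s| <= 1 -> `|s * x| <= 1 ->
  `|ramp s j x| <= 120 * 32.
Proof.
move=> j4 s1 sx; rewrite /ramp !normrM !normrX.
(* Here 120 is [5!], which bounds the falling factorials, and 32 is [2 ^ 5], the positive part being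
   at most 2. *)
apply: ler_pM => //.
  apply: (@le_trans _ _ (1 * 120)); last by rewrite mul1r.
  apply: ler_pM => //; first exact: exprn_ile1.
  rewrite normr_nat (ler_nat R _ 120).
  by move: j4; do 5 (case: j => [//|j]).
apply: (@le_trans _ _ (2 ^+ (5 - j))).
  apply: lerXn2r; rewrite ?nnegrE//.
  have : 0 <= Num.max (1 + s * x) 0 by rewrite le_max lexx orbT.
  move=> /ger0_norm ->; rewrite ge_max ler0n andbT.
  have := le_trans (ler_norm _) sx; lra.
rewrite (_ : 32 = 2 ^+ 5); last by rewrite -natrX.
by apply: ler_weXn2l; [rewrite ler1n|exact: leq_subr].
Qed.

Lemma cutoff_bounded : exists B : R, forall m j x, (j <= 4)%N ->
  `|cutoff m j x| <= B.
Proof.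
pose C : R := 120 * 32.
have C0 : 0 <= C by rewrite mulr_ge0.
(* Unfolded, [jet_mul] at level [k] is a sum of [2 ^ k] products. *)
have HB k (F G : nat -> R -> R) (x : R) :
    (forall j, (j <= k)%N -> `|F j x| <= C) ->
    (forall j, (j <= k)%N -> `|G j x| <= C) ->
    `|jet_mul F G k x| <= 2 ^+ k * (C * C).
  elim: k F G => [|k IH] F G FC GC /=.
    by rewrite mul1r normrM ler_pM// ?FC ?GC.
  rewrite (le_trans (ler_normD _ _))// exprS -mulrA mulr_natl mulr2n lerD//.
    by apply: IH => j jk; [exact: FC|apply: GC; exact: leqW].
  by apply: IH => j jk; [apply: FC; exact: leqW|exact: GC].
exists (2 ^+ 4 * (C * C)) => m j x j4.
have [mx|xm] := leP m.+1%:R `|x|.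
  by rewrite cutoff_eq0// normr0 !mulr_ge0.
have m0 : 0 < m.+1%:R :> R by rewrite ltr0n.
have s1 : `|m.+1%:R^-1 : R| <= 1.
  by rewrite normfV normr_nat invf_le1// ler1n.
have sx : `|m.+1%:R^-1 * x| <= 1.
  by rewrite normrM normfV normr_nat ler_pdivrMl// mulr1 ltW.
apply: le_trans (HB j _ _ x _ _) _.
- by move=> i ij; apply: le_ramp => //; exact: leq_trans j4.
- move=> i ij; apply: le_ramp; rewrite ?mulNr ?normrN//; exact: leq_trans j4.
by rewrite ler_wpM2r ?mulr_ge0// ler_weXn2l// ler1n.
Qed.

Lemma cvg_ramp (s_ : nat -> R) j x : s_ m @[m --> \oo] --> (0 : R) ->
  ramp (s_ m) j x @[m --> \oo] --> jet1 j x.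
Proof.
move=> s0.
(* The limit is the ramp of slope 0: [0 ^+ j] keeps only [j = 0]. *)
have -> : jet1 j x = 0 ^+ j * (5 ^_ j)%:R * Num.max (1 + 0 * x) 0 ^+ (5 - j).
  rewrite mul0r addr0 max_l// expr1n mulr1 /jet1.
  by case: j => [|j]; [rewrite expr0 mul1r|rewrite expr0n mul0r].
apply: cvgM.
  apply: cvgM; last exact: cvg_cst.
  apply: (cvg_comp s_ (fun v => v ^+ j)); first exact: s0.
  exact: exprn_continuous.
apply: (cvg_comp (fun m => 1 + s_ m * x) (fun v => Num.max v 0 ^+ (5 - j))).
  by apply: cvgD; [exact: cvg_cst|apply: cvgM; [exact: s0|exact: cvg_cst]].
exact: continuous_pos_part_exp.
Qed.

Lemma cvg_cutoff j x : cutoff m j x @[m --> \oo] --> jet1 j x.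
Proof.
rewrite -(jet_mul1 j jet1); apply: cvg_jet_mul => i _; apply: cvg_ramp.
  exact: cvg_harmonic.
by rewrite -oppr0; apply: cvgN; exact: cvg_harmonic.
Qed.

End cutoff.

(** * From bounded to general test functions *)

Section truncation.
Context d (T : measurableType d) (R : realType) (P : probability T R).
Variable Z : {RV P >-> R}.

Definition jet_op (n : nat) (c F : nat -> R -> R) (x : R) : R :=
  \sum_(k < n.+1) c k x * F k x.

Lemma uniform_jet_bound (n : nat) (F : nat -> R -> R) :
  (forall k, (k <= n)%N -> exists B, forall x, `|F k x| <= B) ->
  exists B, forall k x, (k <= n)%N -> `|F k x| <= B.
Proof.
elim: n => [|n IH] FB.
  have [B FB0] := FB 0%N (leqnn _).
  by exists B => k x; rewrite leqn0 => /eqP ->.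
have [k kn|B HB] := IH; first by apply: FB; exact: leqW.
have [C HC] := FB n.+1 (leqnn _).
exists (Num.max B C) => k x; rewrite leq_eqVlt => /predU1P[->|kn].
  by rewrite le_max HC orbT.
by rewrite le_max HB.
Qed.

Lemma continuous_support_bounded (f : R -> R) (a : R) :
  continuous f -> (forall x, a <= `|x| -> f x = 0) ->
  exists B, forall x, `|f x| <= B.
Proof.
move=> cf f0; have [a0|a0] := ltP a 0.
  by exists 0 => x; rewrite f0 ?normr0// (le_trans (ltW a0)).
have cnf : {within `[- a, a], continuous (fun x => `|f x|)}.
  apply: continuous_subspaceT => x; apply: (cvg_comp f Num.norm); first exact: cf.
  exact: norm_continuous.
have [|c _ fc] := EVT_max _ cnf; first by rewrite -subr_ge0 opprK addr_ge0.
exists `|f c| => x; have [xa|/ltW ax] := leP `|x| a.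
  by apply: fc; rewrite in_itv/= -ler_norml.
by rewrite f0// normr0.
Qed.

Lemma integrable_jet_mul_bound (w : T -> R) (F : nat -> R -> R) (B : R) k :
  (forall j, (j <= k)%N ->
     P.-integrable [set: T] (EFin \o (fun t => w t * F j (Z t)))) ->
  P.-integrable [set: T] (EFin \o (fun t =>
    `|w t| * jet_mul (fun j y => `|F j y|) (fun _ _ => B) k (Z t))).
Proof.
elim: k F => [|k IH] F wF /=.
  apply: (eq_integrable _ (EFin \o (fun t => B * `|w t * F 0%N (Z t)|))) => //.
    by move=> t _ /=; rewrite normrM; congr EFin; ring.
  by apply: integrable_EFinZl; apply: integrable_norm; exact: wF.
have i1 := IH (jet_shift F) (fun j jk => wF j.+1 jk).
have i2 := IH F (fun j jk => wF j (leqW jk)).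
have := integrable_EFinD i1 i2; apply: eq_integrable => // t _ /=.
by rewrite -mulrDr.
Qed.

(** The product of [F] with a cutoff has compact support, hence bounded levels, so the identity
    holds for it; dominated convergence removes the cutoff. Integrability is asked for all [j <= k]
    because level [k] of the product involves every [F j] with [j <= k]. *)
Lemma mean0_jet_op n (c F : nat -> R -> R) : (n <= 4)%N -> jet n F ->
  (forall k, (k <= n)%N -> continuous (c k)) ->
  (forall k j, (j <= k <= n)%N ->
     P.-integrable [set: T] (EFin \o (fun t => c k (Z t) * F j (Z t)))) ->
  (forall G, jet n G ->
     (forall k, (k <= n)%N -> exists B, forall x, `|G k x| <= B) ->
     \int[P]_t jet_op n c G (Z t) = 0) ->
  mean0 P (fun t => jet_op n c F (Z t)).
Proof.
move=> n4 jF cc icF H.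
have iE (f : nat -> T -> R) : (forall k, (k <= n)%N ->
    P.-integrable [set: T] (EFin \o f k)) ->
    P.-integrable [set: T] (EFin \o (fun t => \sum_(k < n.+1) f k t)).
  move=> intf.
  have := @integrable_sum _ _ _ P _ measurableT _ (index_enum 'I_n.+1) xpredT
    (fun k => EFin \o f k) (fun k _ => intf k (leq_ord k)).
  by apply: eq_integrable => // t _ /=; rewrite sumEFin.
split.
  by apply: (iE (fun k t => c k (Z t) * F k (Z t))) => k kn; apply: icF; rewrite leqnn.
have [B HB] := @cutoff_bounded R.
have jG m : jet n (jet_mul F (cutoff m)).
  by apply: jet_jet_mul jF _; exact: jet_leq n4 (jet_cutoff m).
have G0 m : \int[P]_t jet_op n c (jet_mul F (cutoff m)) (Z t) = 0.
  apply: H => // k kn; apply: (@continuous_support_bounded _ m.+1%:R).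
    exact: (jG m).2.
  move=> x mx; apply: jet_mul_eq0r => j jk; apply: cutoff_eq0 => //.
  exact: leq_trans (leq_trans jk kn) n4.
suff : \int[P]_t jet_op n c (jet_mul F (cutoff m)) (Z t) @[m --> \oo] -->
    \int[P]_t jet_op n c F (Z t).
  under eq_fun do rewrite G0.
  by move=> h; exact: (cvg_unique _ h (cvg_cst _)).
apply: (Rintegral_dominated_cvg (g := fun t => \sum_(k < n.+1)
  `|c k (Z t)| * jet_mul (fun j y => `|F j y|) (fun _ _ => B) k (Z t))).
- move=> m; have : continuous (jet_op n c (jet_mul F (cutoff m))).
    move=> x; rewrite /jet_op; apply: (cvg_big add_continuous) => k _.
    by apply: cvgM; [exact/cc/leq_ord|exact/(jG m).2/leq_ord].
  move=> /continuous_measurable_fun mop.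
  exact: (measurableT_comp mop (measurable_funPT Z)).
- move=> t; apply: (cvg_big add_continuous) => k _; apply: cvgM; first exact: cvg_cst.
  rewrite -[X in _ --> X](jet_mul1 k F); apply: cvg_jet_mul => j _.
    exact: cvg_cst.
  exact: cvg_cutoff.
- apply: (iE (fun k t => `|c k (Z t)| *
    jet_mul (fun j y => `|F j y|) (fun _ _ => B) k (Z t))) => k kn.
  by apply: integrable_jet_mul_bound => j jk; apply: icF; rewrite jk.
- move=> m t; rewrite /jet_op (le_trans (ler_norm_sum _ _ _))//.
  apply: ler_sum => k _; rewrite normrM ler_wpM2l// le_jet_mul// => j jk.
  by rewrite HB// (leq_trans jk)// (leq_trans (leq_ord k)).
Qed.

(** The leading coefficient is [x] with no constant term and the others are affine, so the products
    [c k * F j] are combinations of [Z * F j] with [j <= n] and of [F j] with [j < n]: the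
    integrability conditions of the theorem. *)
Lemma mean0_affine_jet_op n (c F : nat -> R -> R) : (n <= 4)%N -> jet n F ->
  (forall k, (k < n)%N -> exists a b, forall x, c k x = a * x + b) ->
  (forall x, c n x = x) ->
  (forall k, (k <= n)%N ->
    P.-integrable [set: T] (EFin \o (fun t => Z t * F k (Z t)))) ->
  (forall k, (k < n)%N -> P.-integrable [set: T] (EFin \o (fun t => F k (Z t)))) ->
  (forall G, jet n G ->
     (forall k, (k <= n)%N -> exists B, forall x, `|G k x| <= B) ->
     \int[P]_t jet_op n c G (Z t) = 0) ->
  mean0 P (fun t => jet_op n c F (Z t)).
Proof.
move=> n4 jF ca cn iZF iF; apply: mean0_jet_op => //.
- move=> k; rewrite leq_eqVlt => /predU1P[->|kn] x.
    by rewrite (funext cn : c n = id); exact: cvg_id.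
  have [a [b cE]] := ca k kn; rewrite (funext cE : c k = _).
  by apply: cvgD; [apply: cvgM; [exact: cvg_cst|exact: cvg_id]|exact: cvg_cst].
- move=> k j /andP[jk]; rewrite leq_eqVlt => /predU1P[kn|kn].
    have := iZF j; rewrite -kn => /(_ jk); apply: eq_integrable => // t _ /=.
    by rewrite kn cn.
  have [a [b cE]] := ca k kn; have jn := leq_ltn_trans jk kn.
  have := integrable_EFinD (integrable_EFinZl a (iZF j (ltnW jn)))
    (integrable_EFinZl b (iF j jn)).
  by apply: eq_integrable => // t _ /=; rewrite cE; congr EFin; ring.
Qed.

End truncation.

(** * Necessity *)

Definition stein_coef4 (R : realType) (muX muY : R) (k : nat) (x : R) : R :=
  nth 0 [:: x - muX * muY; - (1 + muX ^+ 2 + muY ^+ 2); - (2 * x + muX * muY);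
    1; x] k.

Definition stein_coef3 (R : realType) (mu : R) (k : nat) (x : R) : R :=
  nth 0 [:: x - mu ^+ 2; - (x + 1 + mu ^+ 2); 1 - x; x] k.

Lemma jet_op4E (R : realType) (muX muY : R) (F : nat -> R -> R) x :
  jet_op 4 (stein_coef4 muX muY) F x =
  x * F 4 x + F 3 x - (2 * x + muX * muY) * F 2 x
  - (1 + muX ^+ 2 + muY ^+ 2) * F 1 x + (x - muX * muY) * F 0 x.
Proof. by rewrite /jet_op !big_ord_recr big_ord0/= /stein_coef4/=; ring. Qed.

Lemma jet_op3E (R : realType) (mu : R) (F : nat -> R -> R) x :
  jet_op 3 (stein_coef3 mu) F x =
  x * F 3 x + (1 - x) * F 2 x - (x + 1 + mu ^+ 2) * F 1 x
  + (x - mu ^+ 2) * F 0 x.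
Proof. by rewrite /jet_op !big_ord_recr big_ord0/= /stein_coef3/=; ring. Qed.

Section product_stein.
Context d (T : measurableType d) (R : realType) (P : probability T R).
Variables (X Y : {RV P >-> R}) (muX muY : R).
Hypotheses (hX : has_law X (normal_prob muX 1)) (hY : has_law Y (normal_prob muY 1)).
Hypothesis hXY : independent_RV X Y.

Let hYX : independent_RV Y X.
Proof. by move=> A B mA mB; rewrite setIC (hXY mB mA) muleC. Qed.

Section bounded_jet.
Variables (n : nat) (B : R) (F : nat -> R -> R).
Hypothesis jF : jet n F.
Hypothesis FB : forall k x, (k <= n)%N -> `|F k x| <= B.

(** [S1] and [S2] integrate by parts in [Y]; [S3] and [S4] do so in [X], with the roles of the two
    variables exchanged. *)
Let S1 k (kn : (k < n)%N) := stein_mul hX hY hXY (fun x => jF.1 k x kn)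
  (jF.2 k.+1 kn) (fun x => FB x (ltnW kn)) (fun x => FB x kn).
Let S2 k (kn : (k < n)%N) := stein_mul_fst hX hY hXY (fun x => jF.1 k x kn)
  (jF.2 k.+1 kn) (fun x => FB x (ltnW kn)) (fun x => FB x kn).
Let S3 k (kn : (k < n)%N) := stein_mul_snd hY hX hYX (fun x => jF.1 k x kn)
  (jF.2 k.+1 kn) (fun x => FB x (ltnW kn)) (fun x => FB x kn).
Let S4 k (kn : (k < n)%N) := stein_mul hY hX hYX (fun x => jF.1 k x kn)
  (jF.2 k.+1 kn) (fun x => FB x (ltnW kn)) (fun x => FB x kn).

(** Obtained from [S2] at level [k] and [S3] at level [k.+1], whose terms in [X ^+ 2] cancel, plus
    [muY] times [S4] at level [k], which removes [X * F k]. Besides functions of [X * Y], only terms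
    linear in [X] and in [Y] remain. *)
Let Q k t := X t * Y t * F k (X t * Y t) - muX * muY * F k (X t * Y t)
  - muY * (Y t * F k.+1 (X t * Y t)) - muX * (X t * F k.+1 (X t * Y t))
  - F k.+1 (X t * Y t) - X t * Y t * F k.+2 (X t * Y t).

Let mean0Q k : (k.+1 < n)%N -> mean0 P (Q k).
Proof.
move=> kn; have := mean0D (mean0D (S2 (ltnW kn)) (S3 kn)) (mean0Z muY (S4 (ltnW kn))).
congr mean0; apply/funext => t; rewrite /Q [Y t * X t]mulrC; ring.
Qed.

Lemma mean0_bounded4 : (3 < n)%N ->
  mean0 P (fun t => jet_op 4 (stein_coef4 muX muY) F (X t * Y t)).
Proof.
move=> n4; have n3 := ltnW n4; have n2 := ltnW n3.
(* In [Q 0 - Q 2] the terms in [X] and [Y] sit at levels 1 and 3. The first-order identities at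
   level 1 move those of level 1 to level 2, those at level 2 remove the ones of level 3, and the
   leftovers at level 2 cancel. *)
have := mean0D (mean0B (mean0Q n2) (mean0Q n4))
  (mean0D (mean0D (mean0Z muY (S1 n2)) (mean0Z muX (S4 n2)))
          (mean0D (mean0Z muY (S4 n3)) (mean0Z muX (S1 n3)))).
congr mean0; apply/funext => t; rewrite jet_op4E /Q [Y t * X t]mulrC; ring.
Qed.

Lemma mean0_bounded3 mu : muX = mu -> muY = mu -> (2 < n)%N ->
  mean0 P (fun t => jet_op 3 (stein_coef3 mu) F (X t * Y t)).
Proof.
move=> eX eY n3; have n2 := ltnW n3.
(* With equal means, the terms of [Q 0 - Q 1] in [X] and [Y] are [mu * (X + Y)] times [F 2 - F 1],
   which the sum of [S1] and [S4] at level 1 removes at once; this is why order 3 suffices. *)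
have := mean0D (mean0B (mean0Q n2) (mean0Q n3))
  (mean0Z mu (mean0D (S1 n2) (S4 n2))).
congr mean0; apply/funext => t.
by rewrite jet_op3E /Q [Y t * X t]mulrC eX eY; ring.
Qed.

End bounded_jet.

Variable Z : {RV P >-> R}.
Hypothesis hZ : forall t, Z t = X t * Y t.

Lemma mean0_stein4 F : jet 4 F ->
  (forall k, (k <= 4)%N ->
    P.-integrable [set: T] (EFin \o (fun t => Z t * F k (Z t)))) ->
  (forall k, (k <= 3)%N -> P.-integrable [set: T] (EFin \o (fun t => F k (Z t)))) ->
  mean0 P (fun t => jet_op 4 (stein_coef4 muX muY) F (Z t)).
Proof.
move=> jF iZF iF; apply: mean0_affine_jet_op => //.
- case=> [|[|[|[|//]]]] _; [exists 1, (- (muX * muY))|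
    exists 0, (- (1 + muX ^+ 2 + muY ^+ 2))|exists (-2), (- (muX * muY))|
    exists 0, 1] => x; rewrite /stein_coef4/=; ring.
- move=> G jG /uniform_jet_bound[B GB].
  rewrite -(mean0_bounded4 jG GB (ltnSn 3)).2.
  by apply: eq_Rintegral => t _; rewrite hZ.
Qed.

Lemma mean0_stein3 mu F : muX = mu -> muY = mu -> jet 3 F ->
  (forall k, (k <= 3)%N ->
    P.-integrable [set: T] (EFin \o (fun t => Z t * F k (Z t)))) ->
  (forall k, (k <= 2)%N -> P.-integrable [set: T] (EFin \o (fun t => F k (Z t)))) ->
  mean0 P (fun t => jet_op 3 (stein_coef3 mu) F (Z t)).
Proof.
move=> eX eY jF iZF iF; apply: mean0_affine_jet_op => //.
- case=> [|[|[|//]]] _; [exists 1, (- mu ^+ 2)|exists (-1), (- (1 + mu ^+ 2))|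
    exists (-1), 1] => x; rewrite /stein_coef3/=; ring.
- move=> G jG /uniform_jet_bound[B GB].
  rewrite -(mean0_bounded3 jG GB eX eY (ltnSn 2)).2.
  by apply: eq_Rintegral => t _; rewrite hZ.
Qed.

End product_stein.

(** * Characteristic functions *)

Section trig_integrals.
Context d (T : measurableType d) (R : realType) (mu : {finite_measure set T -> \bar R}).
Variable V : T -> R.
Hypothesis mV : measurable_fun [set: T] V.

Let mcomp (f : R -> R) (y : R) : continuous f ->
  measurable_fun [set: T] (fun t => f (y * V t)).
Proof.
move=> cf; apply: (measurableT_comp (continuous_measurable_fun cf)).
exact: measurable_funM.
Qed.

Lemma integrable_bounded (f : T -> R) (B : R) : measurable_fun [set: T] f ->
  (forall t, `|f t| <= B) -> mu.-integrable [set: T] (EFin \o f).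
Proof.
move=> mf fB; apply: (integrable_le (g := cst B)) => //.
exact: finite_measure_integrable_cst.
Qed.

Lemma integrable_cos y : mu.-integrable [set: T] (EFin \o (fun t => cos (y * V t))).
Proof.
apply: (@integrable_bounded _ 1); last by move=> t; exact: cos_max.
exact/mcomp/continuous_cos.
Qed.

Lemma integrable_sin y : mu.-integrable [set: T] (EFin \o (fun t => sin (y * V t))).
Proof.
apply: (@integrable_bounded _ 1); last by move=> t; exact: sin_max.
exact/mcomp/continuous_sin.
Qed.

Hypothesis iV : mu.-integrable [set: T] (EFin \o V).

(** Differentiation under the integral sign, the derivative in [y] being dominated by [|V|]. *)
Let is_derive_integral (f f' : R -> R) (y : R) :
  (forall y, mu.-integrable [set: T] (EFin \o (fun t => f (y * V t)))) ->
  (forall x : R, is_derive x 1 f (f' x)) -> (forall x, `|f' x| <= 1) ->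
  is_derive y 1 (fun y => \int[mu]_t f (y * V t)) (\int[mu]_t (V t * f' (y * V t))).
Proof.
move=> intf df f'1; pose F z t := f (z * V t).
have dF (z : R) t : is_derive z 1 (F ^~ t) (V t * f' (z * V t)).
  have dM : is_derive z 1 (fun z : R => z * V t) (V t).
    by apply: is_derive_eq; rewrite /GRing.scale/=; ring.
  have dfz : is_derive (z * V t) 1 f (f' (z * V t)) by exact: df.
  have := is_derive1_comp (f := f) (g := fun y => y * V t).
  by move=> /(_ _ _ _ dfz dM); rewrite mulrC.
have d1F z t : partial1of2 F z t = V t * f' (z * V t).
  by rewrite partial1of2E; exact: (@derive_val _ _ _ _ _ _ _ (dF z t)).
have yI : `]y - 1, y + 1[%classic y by rewrite /= in_itv/= ltrDl gtrDl ltrN10 ltr01.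
have intF z : `]y - 1, y + 1[%classic z -> mu.-integrable setT (EFin \o F z).
  by move=> _; exact: intf.
have derF z t : `]y - 1, y + 1[%classic z -> [set: T] t -> derivable (F ^~ t) z 1.
  by move=> _ _; exact: (@ex_derive _ _ _ _ _ _ _ (dF z t)).
have FV z t : `]y - 1, y + 1[%classic z -> [set: T] t ->
    `|partial1of2 F z t| <= `|V t|.
  by move=> _ _; rewrite d1F normrM ler_piMr.
have iVn := integrable_norm iV.
have V0 t : 0 <= `|V t| by [].
apply: DeriveDef.
  exact: (derivable_under_integral measurableT yI intF derF V0 iVn FV).
rewrite -derive1E (differentiation_under_integral measurableT yI intF derF V0 iVn FV).
by apply: eq_Rintegral => t _; rewrite d1F.
Qed.

Lemma is_derive_integral_cos (y : R) : is_derive y 1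
  (fun y => \int[mu]_t cos (y * V t)) (\int[mu]_t (V t * - sin (y * V t))).
Proof.
apply: (is_derive_integral _ integrable_cos) => x.
by rewrite normrN; exact: sin_max.
Qed.

Lemma is_derive_integral_sin (y : R) : is_derive y 1
  (fun y => \int[mu]_t sin (y * V t)) (\int[mu]_t (V t * cos (y * V t))).
Proof.
by apply: (is_derive_integral _ integrable_sin) => x; exact: cos_max.
Qed.

End trig_integrals.

(** Differentiation under the integral followed by Stein's identity for [sin (z * x)] gives
    [C' = - z * C]; hence [C z * expR (z ^+ 2 / 2)] is constant, equal to its value 1 at 0. *)
Lemma integral_normal_cos (R : realType) (y : R) :
  \int[normal_prob 0 1]_t cos (y * t) = expR (- y ^+ 2 / 2).
Proof.
pose C (y : R) := \int[normal_prob 0 1]_t cos (y * t).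
have mid : measurable_fun [set: measurableTypeR R] (@idfun R) by exact: measurable_id.
have iid : (normal_prob (0:R) 1).-integrable setT (EFin \o (@idfun R)).
  apply: (integrable_le (mu := normal_prob 0 1) _ _ (integrable_sqr_weight 0)) => // x /=.
  rewrite -(real_normK (num_real x)); move: `|x| => u.
  by have := sqr_ge0 (u ^+ 2); have := sqr_ge0 (u - 1); nra.
have dC (z : R) : is_derive z 1 C (- z * C z).
  have := is_derive_integral_cos (mu := normal_prob 0 1) mid iid z.
  rewrite -/C => dC; apply: (is_derive_eq dC).
  have dg (x : R) : is_derive x 1 (fun x => sin (z * x)) (z * cos (z * x)).
    have dM : is_derive x 1 (fun x : R => z * x) z.
      by apply: is_derive_eq; rewrite /GRing.scale/=; ring.
    have := is_derive1_comp (f := sin) (g := fun y => z * y).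
    by move=> /(_ _ _ _ (is_derive_sin _) dM); rewrite mulrC.
  have c1 x : 1 <= (1 + `|z|) * (1 + x ^+ 2).
    by rewrite mulr_ege1// lerDl ?sqr_ge0.
  have c2 x : `|z| <= (1 + `|z|) * (1 + x ^+ 2).
    apply: (@le_trans _ _ (1 + `|z|)); first by rewrite lerDr.
    by rewrite ler_peMr ?addr_ge0// lerDl sqr_ge0.
  have cM (x : R) : (fun x : R => z * x) u @[u --> x] --> z * x.
    by apply: cvgM; [exact: cvg_cst|exact: cvg_id].
  have cg' : continuous (fun x => z * cos (z * x)).
    move=> x; apply: cvgM; first exact: cvg_cst.
    by apply: (cvg_comp (fun y => z * y) cos) (cM x) _; exact: continuous_cos.
  have gB x : `|sin (z * x)| <= (1 + `|z|) * (1 + x ^+ 2).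
    exact: le_trans (sin_max _) (c1 x).
  have g'B x : `|z * cos (z * x)| <= (1 + `|z|) * (1 + x ^+ 2).
    by rewrite (le_trans _ (c2 x))// normrM ler_piMr// cos_max.
  have stein0 := normal_stein 0 dg cg' gB g'B.
  have icos := integrable_cos (normal_prob 0 1) mid z.
  have isin : (normal_prob 0 1).-integrable setT
      (EFin \o (fun t : R => t * - sin (z * t))).
    have msin : measurable_fun [set: R] (fun t : R => t * - sin (z * t)).
      apply: continuous_measurable_fun => x; apply: cvgM; first exact: cvg_id.
      apply: cvgN.
      by apply: (cvg_comp (fun y => z * y) sin) (cM x) _; exact: continuous_sin.
    apply: (integrable_le (mu := normal_prob 0 1) msin _
      (integrable_norm (mu := normal_prob 0 1) iid)) => x /=.
    by rewrite normrM normrN ler_piMr// sin_max.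
  apply/eqP; rewrite mulNr -addr_eq0 /C; apply/eqP.
  rewrite -(RintegralZl (mu := normal_prob 0 1) z measurableT icos).
  rewrite -(RintegralD (mu := normal_prob 0 1) measurableT isin); last first.
    exact: (integrable_EFinZl (mu := normal_prob 0 1)).
  transitivity (-1 * \int[normal_prob 0 1]_x ((x - 0) * sin (z * x) - z * cos (z * x)));
    last by rewrite stein0 mulr0.
  rewrite -(RintegralZl (mu := normal_prob 0 1))//.
    by apply: eq_Rintegral => t _; rewrite subr0; ring.
  have := integrable_EFinZl (mu := normal_prob 0 1) (-1)
    (integrable_EFinD (mu := normal_prob 0 1) isin
      (integrable_EFinZl (mu := normal_prob 0 1) z icos)).
  apply: (eq_integrable (mu := normal_prob 0 1)) => // t _ /=; congr EFin.
  by rewrite subr0; ring.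
have dK (z : R) : is_derive z 1 (fun z => C z * expR (z ^+ 2 / 2)) 0.
  have dCz := dC z.
  by apply: is_derive_eq; rewrite /GRing.scale/=; field.
have C0 : C 0 = 1.
  rewrite /C; under eq_Rintegral do rewrite mul0r cos0.
  rewrite (Rintegral_cst (normal_prob 0 1))//.
  by rewrite mul1r [X in fine X](@probability_setT _ _ _ (normal_prob (0 : R) 1)).
have := is_derive_0_is_cst y 0 dK.
rewrite C0 expr0n/= mul0r expR0 mul1r => CK.
have e0 : expR (y ^+ 2 / 2) != 0 by rewrite gt_eqF// expR_gt0.
by rewrite -/(C y) mulNr expRN; apply: (mulIf e0); rewrite CK mulVf.
Qed.

Lemma integral_EFinE d (T : measurableType d) (R : realType)
    (mu : {measure set T -> \bar R}) (f : T -> R) :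
  mu.-integrable [set: T] (EFin \o f) ->
  (\int[mu]_x (f x)%:E = (\int[mu]_x f x)%R%:E)%E.
Proof. by move=> intf; rewrite /Rintegral fineK//; exact: integrable_fin_num. Qed.

(** * Concentration of normal laws of small variance *)

Section normal_concentration.
Context {R : realType}.
Implicit Types (s w x e : R).

Lemma normal_pdfC s w x : s != 0 -> normal_pdf w s x = normal_pdf x s w.
Proof.
by move=> s0; rewrite !normal_pdfE// /normal_fun -sqrrN opprB.
Qed.

(** The ratio of the two densities is [2 * expR (- v)] with [v = 3 (x - w)^2 / (8 s^2)], and
    [expR (- v) <= 1 / v]. The resulting constant 16/3 is rounded up to 6. *)
Lemma normal_pdf_tail s w x e : 0 < s -> 0 < e -> e <= `|x - w| ->
  normal_pdf w s x <= 6 * s ^+ 2 / e ^+ 2 * normal_pdf w (2 * s) x.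
Proof.
move=> s0 e0 ex; have s20 : 2 * s != 0 by rewrite mulf_neq0 ?gt_eqF.
rewrite !normal_pdfE ?gt_eqF// ?mulr_gt0// /normal_fun.
have -> : normal_peak (2 * s) = normal_peak s / 2.
  rewrite /normal_peak exprMn -mulrA -mulrnAr sqrtrM; last exact: sqr_ge0.
  by rewrite sqrtr_sqr ger0_norm// invfM mulrC mulrnAr.
rewrite [leRHS](_ : _ = normal_peak s * (3 * s ^+ 2 / e ^+ 2 *
  expR (- (x - w) ^+ 2 / ((2 * s) ^+ 2 *+ 2)))); last by field; rewrite gt_eqF.
rewrite ler_wpM2l ?normal_peak_ge0//.
set u := (x - w) ^+ 2.
have u0 : e ^+ 2 <= u.
  by rewrite /u -(real_normK (num_real (x - w))) lerXn2r ?nnegrE// ltW.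
have e20 : 0 < e ^+ 2 by rewrite exprn_gt0.
have s2 : 0 < s ^+ 2 by rewrite exprn_gt0.
have up : 0 < u by exact: lt_le_trans u0.
clearbody u.
have -> : - u / (s ^+ 2 *+ 2) = - u / ((2 * s) ^+ 2 *+ 2) + - (3 * u / (8 * s ^+ 2)).
  by field; rewrite gt_eqF.
rewrite expRD [leRHS]mulrC ler_wpM2l ?expR_ge0// expRN.
set v := 3 * u / (8 * s ^+ 2).
have v0 : 0 < v by rewrite divr_gt0// mulr_gt0.
have ve : v <= expR v by rewrite (le_trans _ (expR_ge1Dx v))// lerDr.
rewrite (@le_trans _ _ v^-1)// ?lef_pV2 ?posrE ?expR_gt0//.
rewrite /v invf_div ler_pdivrMr ?mulr_gt0//.
rewrite mulrAC ler_pdivlMr//.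
by nra.
Qed.

(** A Chebyshev-type bound: the density of doubled deviation has total mass 1. *)
Lemma normal_prob_tail s w e (A : set R) : 0 < s -> 0 < e -> measurable A ->
  (forall x, A x -> e <= `|x - w|) ->
  (normal_prob w s A <= (6 * s ^+ 2 / e ^+ 2)%:E)%E.
Proof.
move=> s0 e0 mA Ae; set c := 6 * s ^+ 2 / e ^+ 2.
have c0 : 0 <= c by rewrite divr_ge0 ?sqr_ge0// mulr_ge0 ?sqr_ge0.
have mp s' : measurable_fun [set: R] (fun x => (normal_pdf w s' x)%:E).
  by apply/measurable_EFinP; exact: measurable_normal_pdf.
rewrite /normal_prob.
apply: (@le_trans _ _ (\int[lebesgue_measure]_(x in A)
   (c%:E * (normal_pdf w (2 * s) x)%:E))%E).
  apply: ge0_le_integral => //.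
  - by move=> x _; rewrite lee_fin normal_pdf_ge0.
  - exact: measurable_funTS (mp s).
  - by apply: measurable_funeM; exact: measurable_funTS (mp _).
  - by move=> x Ax; rewrite -EFinM lee_fin normal_pdf_tail//; exact: Ae.
rewrite ge0_integralZl//; last 2 first.
- exact: measurable_funTS (mp _).
- by move=> x _; rewrite lee_fin normal_pdf_ge0.
rewrite -[leRHS]mule1 lee_wpmul2l// -(integral_normal_pdf w (2 * s)).
apply: ge0_subset_integral => //; first exact: mp.
by move=> x _; rewrite lee_fin normal_pdf_ge0.
Qed.

End normal_concentration.

(** * Smoothed laws and uniqueness of characteristic functions *)

Section uniqueness.
Context {R : realType} d (T : measurableType d) (Q : probability T R).
Variable W : {RV Q >-> R}.
Implicit Types (a b s x y : R).

(** Fubini for [cos (y * (W - a) * u)]: integrating in [u] first gives the Gaussian by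
    [integral_normal_cos], integrating over [Q] first gives the right-hand side by the addition
    formula. *)
Lemma Rintegral_gauss_cos a y :
  \int[Q]_t expR (- (y * (W t - a)) ^+ 2 / 2) =
  \int[normal_prob 0 1]_u
    (cos (u * y * a) * (\int[Q]_t cos (u * y * W t)) +
     sin (u * y * a) * (\int[Q]_t sin (u * y * W t))).
Proof.
pose k (p : T * measurableTypeR R) := cos (y * (W p.1 - a) * p.2).
have mW : measurable_fun [set: T] W by exact: measurable_funPT.
have mid : measurable_fun [set: measurableTypeR R] (@idfun R).
  exact: measurable_id.
have mk : measurable_fun [set: T * measurableTypeR R] k.
  apply: (measurableT_comp (continuous_measurable_fun (@continuous_cos R))).
  apply: measurable_funM; last exact: measurable_snd.
  apply: measurable_funM => //; apply: measurable_funB => //.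
  exact: (measurableT_comp mW measurable_fst).
have ik : (Q \x normal_prob 0 1)%E.-integrable
    [set: T * measurableTypeR R] (EFin \o k).
  apply: (integrable_le (mu := (Q \x normal_prob 0 1)%E) mk (g := cst 1)).
    by move=> p; exact: cos_max.
  apply/integrableP; split; first exact/measurable_EFinP.
  rewrite (eq_integral (cst 1%E)); last by move=> p _ /=; rewrite normr1.
  rewrite integral_cst// mul1e -setXTT.
  rewrite [ltLHS](@product_measure1E _ _ _ _ R Q (normal_prob 0 1) _ _
    measurableT measurableT).
  apply: (@le_lt_trans _ _ (1 * 1)%E); last by rewrite mule1 ltry.
  apply: lee_pmul => //; first exact: probability_le1.
  exact: (probability_le1 (normal_prob 0 1)).
have := @Fubini _ _ _ _ R Q (normal_prob 0 1) (EFin \o k) ik.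
move=> h.
transitivity (fine (\int[Q]_t \int[normal_prob 0 1]_u (EFin \o k) (t, u))%E).
  rewrite {1}/Rintegral; congr fine; apply: eq_integral => t _.
  rewrite /= -integral_normal_cos integral_EFinE//.
  exact: (integrable_cos (normal_prob 0 1) mid (y * (W t - a))).
rewrite h; rewrite {1}/Rintegral; congr fine; apply: eq_integral => u _.
rewrite /k/=.
have ic := integrable_cos Q mW (u * y); have is' := integrable_sin Q mW (u * y).
rewrite -(RintegralZl _ measurableT ic) -(RintegralZl _ measurableT is').
rewrite -RintegralD//; last 2 first.
- exact: integrable_EFinZl.
- exact: integrable_EFinZl.
rewrite -integral_EFinE; last first.
  by apply: integrable_EFinD; exact: integrable_EFinZl.
apply: eq_integral => t _; congr EFin.
by rewrite -cosB -cosN; congr cos; ring.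
Qed.

Lemma integral_normal_pdf_RV s x : s != 0 ->
  (\int[Q]_t (normal_pdf x s (W t))%:E =
   (normal_peak s * (\int[Q]_t expR (- (s^-1 * (W t - x)) ^+ 2 / 2))%R)%:E)%E.
Proof.
move=> s0; have mW : measurable_fun [set: T] W by exact: measurable_funPT.
have E t : normal_pdf x s (W t) =
    normal_peak s * expR (- (s^-1 * (W t - x)) ^+ 2 / 2).
  by rewrite normal_pdfE// /normal_fun; congr (_ * expR _); field.
have mp : measurable_fun [set: T] (fun t => normal_pdf x s (W t)).
  exact: (measurableT_comp (measurable_normal_pdf x s) mW).
have me : measurable_fun [set: T] (fun t => expR (- (s^-1 * (W t - x)) ^+ 2 / 2)).
  apply: measurableT_comp => //; apply: measurable_funM => //.
  apply: measurableT_comp => //; apply: (measurable_funX 2).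
  by apply: measurable_funM => //; exact: measurable_funB.
rewrite integral_EFinE.
  rewrite -RintegralZl//.
    by congr EFin; apply: eq_Rintegral => t _; exact: E.
  apply: (@integrable_bounded _ _ _ Q _ 1 me) => t.
  rewrite ger0_norm ?expR_ge0// expR_le1 mulNr oppr_le0.
  by rewrite mulr_ge0 ?sqr_ge0// invr_ge0.
apply: (@integrable_bounded _ _ _ Q _ (normal_peak s) mp) => t.
by rewrite ger0_norm ?normal_pdf_ge0//; exact: normal_pdf_ub.
Qed.

Section smoothing.
Variables (s : R) (A : set R).
Hypotheses (s0 : s != 0) (mA : measurable A).

Let f (p : T * measurableTypeR R) := (normal_pdf (W p.1) s p.2 * \1_A p.2)%:E.

Let f0 p : (0 <= f p)%E.
Proof. by rewrite lee_fin mulr_ge0// normal_pdf_ge0. Qed.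

Let mf : measurable_fun [set: T * measurableTypeR R] f.
Proof.
have mW : measurable_fun [set: T] W by exact: measurable_funPT.
apply/measurable_EFinP; apply: measurable_funM.
  under eq_fun do rewrite normal_pdfE//.
  apply: measurable_funM => //; apply: measurableT_comp => //.
  apply: measurable_funM => //; apply: measurableT_comp => //.
  apply: (measurable_funX 2); apply: measurable_funB; first exact: measurable_snd.
  exact: (measurableT_comp mW measurable_fst).
by apply: (measurableT_comp _ measurable_snd); exact: measurable_indic.
Qed.

Let normal_probE t : normal_prob (W t) s A = (\int[lebesgue_measure]_x f (t, x))%E.
Proof.
rewrite /normal_prob integral_mkcond epatch_indic.
by apply: eq_integral => x _; rewrite /f EFinM.
Qed.

Lemma measurable_normal_prob_RV :
  measurable_fun [set: T] (fun t => normal_prob (W t) s A).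
Proof.
under eq_fun do rewrite normal_probE.
exact: (measurable_fun_fubini_tonelli_F (m2 := lebesgue_measure) f).
Qed.

(** Tonelli, with the density symmetric in its mean and its argument: the law of [W] plus an
    independent normal noise has density [x |-> E[normal_pdf x s W]]. *)
Lemma integral_normal_prob_RV :
  (\int[Q]_t normal_prob (W t) s A = \int[lebesgue_measure]_x
    ((\int[Q]_t (normal_pdf x s (W t))%:E) * (\1_A x)%:E))%E.
Proof.
under eq_integral do rewrite normal_probE.
rewrite (fubini_tonelli (m1 := Q) (m2 := lebesgue_measure) f)//.
apply: eq_integral => x _; rewrite -ge0_integralZr//.
- by apply: eq_integral => t _; rewrite /f/= normal_pdfC.
- apply/measurable_EFinP.
  exact: (measurableT_comp (measurable_normal_pdf x s) (measurable_funPT W)).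
- by move=> t _; rewrite lee_fin normal_pdf_ge0.
Qed.

End smoothing.

(* The bandwidth is negligible compared with the shift of the endpoint, so that
   the smoothed indicator converges everywhere, atoms included. *)
Definition ray_approx b (n : nat) (w : R) : R :=
  fine (normal_prob w (n.+1%:R^-1 ^+ 2) `]b + n.+1%:R^-1, +oo[).

Lemma cvg_ray_approx b w :
  ray_approx b n w @[n --> \oo] --> (\1_`]b, +oo[ w : R).
Proof.
have n0 n : 0 < n.+1%:R^-1 :> R by rewrite invr_gt0 ltr0n.
have s0 n : 0 < n.+1%:R^-1 ^+ 2 :> R by rewrite exprn_gt0.
(* Bandwidth [1 / n.+1 ^ 2] against distance [1 / n.+1] leaves a tail of order [1 / n.+1 ^ 2]. *)
have tail (n : nat) A : measurable A -> (forall x, A x -> n.+1%:R^-1 <= `|x - w|) ->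
    (normal_prob w (n.+1%:R^-1 ^+ 2) A <= (6 * n.+1%:R^-1 ^+ 2)%:E)%E.
  move=> mA Ax; have := normal_prob_tail (s0 n) (n0 n) mA Ax.
  by rewrite -exprM -mulrA -expfB// ?gt_eqF.
have fin n A : measurable A -> normal_prob w (n.+1%:R^-1 ^+ 2) A \is a fin_num.
  by move=> mA; exact: (fin_num_measure (normal_prob w (n.+1%:R^-1 ^+ 2))).
have h0 : 6 * n.+1%:R^-1 ^+ 2 @[n --> \oo] --> (0 : R).
  rewrite -[X in _ --> X](mulr0 6); apply: cvgM; first exact: cvg_cst.
  rewrite -[X in _ --> X](expr0n R 2).
  apply: (cvg_comp (fun n => n.+1%:R^-1) (fun x => x ^+ 2)).
    exact: cvg_harmonic.
  exact: exprn_continuous.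
have [bw|wb] := ltP b w.
  rewrite indicE mem_set/=; last by rewrite in_itv/= bw.
  have h1 : 1 - 6 * n.+1%:R^-1 ^+ 2 @[n --> \oo] --> (1 : R).
    by rewrite -[X in _ --> X]subr0; apply: cvgB => //; exact: cvg_cst.
  apply: (squeeze_cvgr _ h1); last exact: cvg_cst.
  have e0 : 0 < (w - b) / 2 by rewrite divr_gt0// subr_gt0.
  near=> n.
  have nb : n.+1%:R^-1 < (w - b) / 2.
    by near: n; exact: (near_infty_natSinv_lt (PosNum e0)).
  rewrite /ray_approx; set A := [set` _].
  have mA : measurable A by exact: measurable_itv.
  (* For [w > b] the tail bound is applied to the complement of the ray, which is eventually at
     distance at least [1 / n.+1] from [w]. *)
  have mCA : measurable (~` A) by exact: measurableC.
  have : normal_prob w (n.+1%:R^-1 ^+ 2) (~` A) =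
      (1 - normal_prob w (n.+1%:R^-1 ^+ 2) A)%E.
    exact: (probability_setC (normal_prob w (n.+1%:R^-1 ^+ 2))).
  have := tail n (~` A) mCA; rewrite -(fineK (fin n A mA)) => + CE.
  rewrite CE -EFinB lee_fin lerBlDl -lerBlDr => ->; last first.
    move=> x; rewrite /A /= in_itv/= andbT => /negP; rewrite -leNgt => xb.
    rewrite distrC (le_trans _ (ler_norm _))//.
    by move: (n.+1%:R^-1 : R) nb xb => e; clear; lra.
  rewrite -lee_fin fineK ?fin//.
  exact: (probability_le1 (normal_prob w (n.+1%:R^-1 ^+ 2))).
(* For [w <= b], the case [w = b] included, the shifted ray itself stays at distance at least
   [1 / n.+1] from [w]. *)
rewrite indicE memNset/=; last by rewrite in_itv/= ltNge wb.
apply: (squeeze_cvgr _ (cvg_cst 0) h0); near=> n.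
rewrite /ray_approx; set A := [set` _].
have mA : measurable A by exact: measurable_itv.
rewrite fine_ge0 ?(measure_ge0 (normal_prob w (n.+1%:R^-1 ^+ 2)))//=.
rewrite -lee_fin fineK ?fin//; apply: tail => // x.
rewrite /A /= in_itv/= andbT => xb.
rewrite (le_trans _ (ler_norm _))//.
by move: (n.+1%:R^-1 : R) xb wb => e; clear; lra.
Unshelve. all: by end_near. Qed.

Let bandwidth_neq0 n : n.+1%:R^-1 ^+ 2 != 0 :> R.
Proof. by rewrite expf_neq0// invr_eq0 pnatr_eq0. Qed.

(** The law of [W] enters the right-hand side only through Gaussian integrals that
    [Rintegral_gauss_cos] expresses by the characteristic function. *)
Lemma Rintegral_ray_approx b n : \int[Q]_t ray_approx b n (W t) =
  fine (\int[lebesgue_measure]_x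
    ((normal_peak (n.+1%:R^-1 ^+ 2) *
      \int[Q]_t expR (- ((n.+1%:R^-1 ^+ 2)^-1 * (W t - x)) ^+ 2 / 2))%R%:E *
     (\1_`](b + n.+1%:R^-1)%R, +oo[ x)%:E))%E.
Proof.
rewrite {1}/Rintegral; congr fine.
transitivity (\int[Q]_t
    normal_prob (W t) (n.+1%:R^-1 ^+ 2)%R `](b + n.+1%:R^-1)%R, +oo[)%E.
  apply: eq_integral => t _; rewrite /ray_approx fineK//.
  apply: (fin_num_measure (normal_prob (W t) (n.+1%:R^-1 ^+ 2))).
  exact: measurable_itv.
rewrite integral_normal_prob_RV//.
by apply: eq_integral => x _; rewrite integral_normal_pdf_RV.
Qed.

Lemma cvg_Rintegral_ray_approx b :
  \int[Q]_t ray_approx b n (W t) @[n --> \oo] -->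
  fine (distribution Q W `]b, +oo[).
Proof.
have -> : fine (distribution Q W `]b, +oo[) = \int[Q]_t \1_`]b, +oo[ (W t).
  rewrite /Rintegral; congr fine.
  transitivity (\int[distribution Q W]_x (\1_`]b, +oo[ x : R)%:E)%E.
    by rewrite integral_indic// setIT.
  by rewrite ge0_integral_distribution//; exact/measurable_EFinP.
apply: (Rintegral_dominated_cvg (mu := Q) (f_ := fun n t => ray_approx b n (W t))
  (f := fun t => \1_`]b, +oo[ (W t)) (g := cst 1)).
- move=> n; apply: (measurableT_comp (f := fine)) => //.
  exact: measurable_normal_prob_RV.
- by move=> t; exact: cvg_ray_approx.
- exact: finite_measure_integrable_cst.
- move=> n t; rewrite /ray_approx ger0_norm; last first.
    exact/fine_ge0/(measure_ge0 (normal_prob (W t) (n.+1%:R^-1 ^+ 2))).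
  have mA : measurable [set` `]b + n.+1%:R^-1, +oo[] by exact: measurable_itv.
  rewrite -lee_fin fineK.
    exact: (probability_le1 (normal_prob (W t) (n.+1%:R^-1 ^+ 2))).
  exact: (fin_num_measure (normal_prob (W t) (n.+1%:R^-1 ^+ 2))).
Qed.

End uniqueness.

(** Open rays are stable under intersection and generate the Borel sets, and the rays starting at
    [- k] exhaust the line with finite mass. *)
Lemma equal_in_law_rays (R : realType) d d' (T : measurableType d)
    (T' : measurableType d') (P : probability T R) (Q : probability T' R)
    (Z : {RV P >-> R}) (W : {RV Q >-> R}) :
  (forall b, distribution Q W `]b, +oo[ = distribution P Z `]b, +oo[) ->
  equal_in_law W Z.
Proof.
move=> WZ A mA.
apply: (@g_sigma_algebra_measure_unique _ R _ (@RGenOInfty.G R) _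
  (fun k => `](- k%:R), +oo[%classic)) => //.
- by move=> _ [x ->]; exact: measurable_itv.
- by move=> k; exists (- k%:R).
- apply/seteqP; split=> // x _; exists (Num.bound `|x|) => //=.
  rewrite in_itv/= andbT ltrNl.
  by rewrite (le_lt_trans _ (archi_boundP (normr_ge0 x)))// -normrN ler_norm.
- move=> _ _ [x ->] [y ->]; exists (Num.max x y).
  apply/seteqP; split=> z /=; rewrite !in_itv/= !andbT gt_max; first by case=> -> ->.
  by move=> /andP[].
- by move=> _ [b ->]; exact: WZ.
- by move=> k; rewrite ltey_eq fin_num_measure//; exact: measurable_itv.
(* The sigma-algebra of [R] is generated by the half-open intervals [ocitv]; open rays generate the
   same one. *)
- by move: mA; rewrite -[X in X -> _]/((@ocitv R).-sigma.-measurable A)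
    RGenOInfty.measurableE.
Qed.

Lemma equal_in_law_trig (R : realType) d d' (T : measurableType d)
    (T' : measurableType d') (P : probability T R) (Q : probability T' R)
    (Z : {RV P >-> R}) (W : {RV Q >-> R}) :
  (forall y, \int[Q]_t cos (y * W t) = \int[P]_t cos (y * Z t)) ->
  (forall y, \int[Q]_t sin (y * W t) = \int[P]_t sin (y * Z t)) ->
  equal_in_law W Z.
Proof.
move=> WZcos WZsin; apply: equal_in_law_rays => b.
have mI := measurable_itv `]b, +oo[.
rewrite -[LHS]fineK ?fin_num_measure// -[RHS]fineK ?fin_num_measure//.
congr EFin.
have hW := @cvg_Rintegral_ray_approx _ _ _ _ W b.
have := @cvg_Rintegral_ray_approx _ _ _ _ Z b.
have -> : (fun n => \int[P]_t ray_approx b n (Z t)) =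
    (fun n => \int[Q]_t ray_approx b n (W t)).
  apply/funext => n; rewrite !Rintegral_ray_approx; congr fine.
  apply: eq_integral => x _; congr (_%:E * _)%E; congr (_ * _).
  rewrite !Rintegral_gauss_cos; apply: eq_Rintegral => u _.
  by rewrite WZcos WZsin.
by move=> hZ; exact: (cvg_unique _ hW hZ).
Qed.

(** * Sufficiency *)

Section derivative_jets.
Context {R : realType}.
Implicit Types (f : R -> R) (F : nat -> R -> R) (n k : nat).

Lemma class_C_jet n f : class_C n f -> jet n (fun k => derive1n k f).
Proof.
move=> [df cf]; split=> [k x kn|k kn]; last exact: cf.
by rewrite derive1nS derive1E; apply: derivableP; exact: df.
Qed.

Lemma derive1n_jet n F k : jet n F -> (k <= n)%N -> derive1n k (F 0%N) = F k.
Proof.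
move=> [dF _]; elim: k => [//|k IH] kn.
rewrite derive1nS IH ?(ltnW kn)//; apply/funext => x.
by rewrite derive1E; exact: (@derive_val _ _ _ _ _ _ _ (dF k x kn)).
Qed.

Lemma jet_class_C n F : jet n F -> class_C n (F 0%N).
Proof.
move=> jF; split=> [k x kn|k kn].
  rewrite (derive1n_jet jF (ltnW kn)).
  exact: (@ex_derive _ _ _ _ _ _ _ (jF.1 k x kn)).
by rewrite (derive1n_jet jF kn); exact: jF.2.
Qed.

(** Coefficients of [cos (y * x)] and [sin (y * x)] in the [k]-th derivative of
    [a * cos (y * x) + b * sin (y * x)]. *)
Definition trig_coef (y a b : R) k : R * R :=
  iter k (fun p => (y * p.2, - y * p.1)) (a, b).

Definition trig_jet (y a b : R) k (x : R) : R :=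
  (trig_coef y a b k).1 * cos (y * x) + (trig_coef y a b k).2 * sin (y * x).

Lemma jet_trig n y a b : jet n (trig_jet y a b).
Proof.
have dM (x : R) : is_derive x 1 (fun x : R => y * x) y.
  by apply: is_derive_eq; rewrite /GRing.scale/=; ring.
have dt k (x : R) : is_derive x 1 (trig_jet y a b k) (trig_jet y a b k.+1 x).
  have dc : is_derive x 1 (fun x => cos (y * x)) (- sin (y * x) * y).
    have := is_derive1_comp (f := cos) (g := fun x => y * x).
    by move=> /(_ _ _ _ (is_derive_cos _) (dM x)).
  have ds : is_derive x 1 (fun x => sin (y * x)) (cos (y * x) * y).
    have := is_derive1_comp (f := sin) (g := fun x => y * x).
    by move=> /(_ _ _ _ (is_derive_sin _) (dM x)).
  rewrite /trig_jet; apply: is_derive_eq.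
  by rewrite /GRing.scale/= /trig_coef/=; ring.
split=> [k x _|k _]; first exact: dt.
exact: derivable_continuous (dt k).
Qed.

Lemma trig_jet_bounded y a b k : exists B, forall x, `|trig_jet y a b k x| <= B.
Proof.
exists (`|(trig_coef y a b k).1| + `|(trig_coef y a b k).2|) => x.
rewrite (le_trans (ler_normD _ _))// !normrM lerD// ler_piMr//.
  exact: cos_max.
exact: sin_max.
Qed.

(* The operator of part (i) factors through the one of part (ii): it is the
   latter applied to f + f'. *)
Lemma jet_op3_trig mu y a b x :
  jet_op 3 (stein_coef3 mu) (trig_jet y (a + y * b) (b - y * a)) x =
  jet_op 4 (stein_coef4 mu mu) (trig_jet y a b) x.
Proof. by rewrite jet_op3E jet_op4E /trig_jet /trig_coef/=; ring. Qed.

End derivative_jets.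

Section linear_system.
Context {R : realType}.
Implicit Types (al be u v : R -> R) (y : R).

(** The rotation [be] cancels in the derivative of [D = u^2 + v^2], which is [2 * al * D <= 0]. The
    mean value theorem then gives [D y <= D 0 = 0]. *)
Lemma linear_system_eq0 al be u v :
  (forall y : R, is_derive y 1 u (al y * u y - be y * v y)) ->
  (forall y : R, is_derive y 1 v (be y * u y + al y * v y)) ->
  (forall y, 0 <= y -> al y <= 0) -> u 0 = 0 -> v 0 = 0 ->
  forall y, 0 <= y -> u y = 0 /\ v y = 0.
Proof.
move=> du dv al0 u0 v0 y; rewrite le_eqVlt => /predU1P[<-//|y0].
pose D z := u z ^+ 2 + v z ^+ 2.
have dD (z : R) : is_derive z 1 D (2 * al z * D z).
  have := du z; have := dv z => ? ?.
  apply: is_derive_eq; rewrite /GRing.scale/= /D; ring.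
have cD : {within `[0, y], continuous D}.
  by apply: continuous_subspaceT; exact: derivable_continuous dD.
have [c] := MVT y0 (fun z _ => dD z) cD.
rewrite in_itv/= => /andP[c0 _] Dy.
have : D y <= 0.
  have D0 : D 0 = 0 by rewrite /D u0 v0 expr0n addr0.
  rewrite -[D y]subr0 -{1}D0 Dy subr0 mulr_le0_ge0 ?(ltW y0)//.
  by rewrite mulr_le0_ge0 ?addr_ge0 ?sqr_ge0// pmulr_rle0// al0// ltW.
have := sqr_ge0 (u y); have := sqr_ge0 (v y); rewrite /D => v2 u2 D2.
split; apply/eqP; rewrite -sqrf_eq0 eq_le ?u2 ?v2 andbT; lra.
Qed.

End linear_system.

Lemma Rintegral_lin3 d (T : measurableType d) (R : realType)
    (mu : {measure set T -> \bar R}) (p q r : R) (f g h : T -> R) :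
  mu.-integrable [set: T] (EFin \o f) -> mu.-integrable [set: T] (EFin \o g) ->
  mu.-integrable [set: T] (EFin \o h) ->
  \int[mu]_t (p * f t + q * g t + r * h t) =
  p * \int[mu]_t f t + q * \int[mu]_t g t + r * \int[mu]_t h t.
Proof.
move=> intf intg inth.
rewrite RintegralD//; last 2 first.
- by apply: integrable_EFinD; exact: integrable_EFinZl.
- exact: integrable_EFinZl.
by rewrite RintegralD ?RintegralZl//; exact: integrable_EFinZl.
Qed.

(** * The differential equation of the characteristic function *)

Section stein_characteristic.
Context {R : realType} (muX muY : R).

(* On x |-> exp (i y x) the Stein identity becomes the first-order equation
   phi' = (stein_damping + i * stein_rotation) * phi for the characteristic
   function phi. *)
Definition stein_damping (y : R) : R :=
  - (y ^+ 3 + (1 + muX ^+ 2 + muY ^+ 2) * y) / (1 + y ^+ 2) ^+ 2.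

Definition stein_rotation (y : R) : R :=
  muX * muY * (1 - y ^+ 2) / (1 + y ^+ 2) ^+ 2.

Definition stein_null d (T : measurableType d) (Q : probability T R)
    (W : {RV Q >-> R}) : Prop :=
  forall y a b : R,
    \int[Q]_t jet_op 4 (stein_coef4 muX muY) (trig_jet y a b) (W t) = 0.

Section one_variable.
Context d (T : measurableType d) (Q : probability T R) (W : {RV Q >-> R}).
Hypothesis iW : Q.-integrable [set: T] (EFin \o W).
Hypothesis W0 : stein_null W.

Let mW : measurable_fun [set: T] W. Proof. exact: measurable_funPT. Qed.

Let integrable_mulW (f : R -> R) (y : R) : continuous f -> (forall x, `|f x| <= 1) ->
  Q.-integrable [set: T] (EFin \o (fun t => W t * f (y * W t))).
Proof.
move=> cf f1; apply: (integrable_le _ _ (integrable_norm iW)) => [|t /=].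
  apply: measurable_funM => //.
  apply: (measurableT_comp (continuous_measurable_fun cf)).
  exact: measurable_funM.
by rewrite normrM ler_piMr.
Qed.

Let ic (y : R) := integrable_cos Q mW y.
Let is_ (y : R) := integrable_sin Q mW y.

Let weight_neq0 (y : R) : (1 + y ^+ 2) ^+ 2 != 0.
Proof. by rewrite expf_neq0// gt_eqF// ltr_wpDr// sqr_ge0. Qed.

Lemma is_derive_char_cos (y : R) :
  is_derive y 1 (fun y => \int[Q]_t cos (y * W t))
    (stein_damping y * (\int[Q]_t cos (y * W t)) -
     stein_rotation y * \int[Q]_t sin (y * W t)).
Proof.
apply: (is_derive_eq (is_derive_integral_cos mW iW y)).
have iWs : Q.-integrable [set: T] (EFin \o (fun t => W t * - sin (y * W t))).
  apply: (@integrable_mulW (fun x => - sin x)) => x; last first.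
    by rewrite normrN sin_max.
  by apply: cvgN; exact: continuous_sin.
(* For the test function [sin (y * x)] the terms carrying a factor [x] add up to
   [(1 + 2 y^2 + y^4) x sin (y x)], hence the weight [(1 + y^2)^2]. *)
have := W0 y 0 1; under eq_Rintegral => t _.
  rewrite (_ : jet_op _ _ _ _ = - (1 + y ^+ 2) ^+ 2 * (W t * - sin (y * W t)) +
    muX * muY * (y ^+ 2 - 1) * sin (y * W t) +
    - (y ^+ 3 + (1 + muX ^+ 2 + muY ^+ 2) * y) * cos (y * W t)); last first.
    by rewrite jet_op4E /trig_jet /trig_coef/=; ring.
  over.
rewrite (Rintegral_lin3 _ _ _ iWs (is_ y) (ic y)) => h.
apply: (mulfI (weight_neq0 y)).
move: h; rewrite /stein_damping /stein_rotation.
move: (\int[Q]_t cos (y * W t)) (\int[Q]_t sin (y * W t)) (\int[Q]_t _) => c s S h.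
transitivity (muX * muY * (y ^+ 2 - 1) * s -
    (y ^+ 3 + (1 + muX ^+ 2 + muY ^+ 2) * y) * c).
  by apply/eqP; rewrite -subr_eq0 -oppr_eq0; apply/eqP; rewrite -h; ring.
by field; rewrite gt_eqF// ltr_wpDr// sqr_ge0.
Qed.

Lemma is_derive_char_sin (y : R) :
  is_derive y 1 (fun y => \int[Q]_t sin (y * W t))
    (stein_rotation y * (\int[Q]_t cos (y * W t)) +
     stein_damping y * \int[Q]_t sin (y * W t)).
Proof.
apply: (is_derive_eq (is_derive_integral_sin mW iW y)).
have iWc := @integrable_mulW cos y (@continuous_cos R) (@cos_max R).
(* The test function is now [cos (y * x)]. *)
have := W0 y 1 0; under eq_Rintegral => t _.
  rewrite (_ : jet_op _ _ _ _ = (1 + y ^+ 2) ^+ 2 * (W t * cos (y * W t)) +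
    muX * muY * (y ^+ 2 - 1) * cos (y * W t) +
    (y ^+ 3 + (1 + muX ^+ 2 + muY ^+ 2) * y) * sin (y * W t)); last first.
    by rewrite jet_op4E /trig_jet /trig_coef/=; ring.
  over.
rewrite (Rintegral_lin3 _ _ _ iWc (ic y) (is_ y)) => h.
apply: (mulfI (weight_neq0 y)).
move: h; rewrite /stein_damping /stein_rotation.
move: (\int[Q]_t cos (y * W t)) (\int[Q]_t sin (y * W t)) (\int[Q]_t _) => c s C h.
transitivity (- (muX * muY * (y ^+ 2 - 1) * c +
    (y ^+ 3 + (1 + muX ^+ 2 + muY ^+ 2) * y) * s)).
  by apply/eqP; rewrite -subr_eq0; apply/eqP; rewrite -h; ring.
by field; rewrite gt_eqF// ltr_wpDr// sqr_ge0.
Qed.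

Lemma char_cos0 : \int[Q]_t cos (0 * W t) = 1.
Proof.
under eq_Rintegral do rewrite mul0r cos0.
by rewrite Rintegral_cst// mul1r [X in fine X](probability_setT Q).
Qed.

Lemma char_sin0 : \int[Q]_t sin (0 * W t) = 0.
Proof.
under eq_Rintegral do rewrite mul0r sin0.
by rewrite Rintegral_cst// mul0r.
Qed.

Lemma char_cosN (y : R) :
  \int[Q]_t cos (- y * W t) = \int[Q]_t cos (y * W t).
Proof. by apply: eq_Rintegral => t _; rewrite mulNr cosN. Qed.

Lemma char_sinN (y : R) :
  \int[Q]_t sin (- y * W t) = - \int[Q]_t sin (y * W t).
Proof.
rewrite -[RHS]mulN1r -(RintegralZl (-1) measurableT (is_ y)).
by apply: eq_Rintegral => t _; rewrite mulNr sinN mulN1r.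
Qed.

End one_variable.

(** Both characteristic functions solve the same linear system with the same value at 0, hence agree
    for [y >= 0]; negative [y] follow by parity of cosine and sine. *)
Lemma stein_null_unique d (T : measurableType d) d' (T' : measurableType d')
    (P : probability T R) (Z : {RV P >-> R})
    (Q : probability T' R) (W : {RV Q >-> R}) :
  P.-integrable [set: T] (EFin \o Z) -> Q.-integrable [set: T'] (EFin \o W) ->
  stein_null Z -> stein_null W -> equal_in_law W Z.
Proof.
move=> iZ iW Z0 W0.
pose u (y : R) := \int[Q]_t cos (y * W t) - \int[P]_t cos (y * Z t).
pose v (y : R) := \int[Q]_t sin (y * W t) - \int[P]_t sin (y * Z t).
have uv0 y : 0 <= y -> u y = 0 /\ v y = 0.
  apply: (@linear_system_eq0 _ stein_damping stein_rotation).
  - move=> z; apply: (is_derive_eq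
      (is_deriveB (is_derive_char_cos iW W0 z) (is_derive_char_cos iZ Z0 z))).
    by rewrite /u /v; ring.
  - move=> z; apply: (is_derive_eq
      (is_deriveB (is_derive_char_sin iW W0 z) (is_derive_char_sin iZ Z0 z))).
    by rewrite /u /v; ring.
  - move=> z z0; rewrite /stein_damping mulNr oppr_le0 divr_ge0 ?sqr_ge0//.
    by rewrite addr_ge0 ?exprn_ge0// mulr_ge0// !addr_ge0 ?sqr_ge0.
  - by rewrite /u !char_cos0 subrr.
  - by rewrite /v !char_sin0 subrr.
apply: equal_in_law_trig => y.
- have [y0|/ltW y0] := leP 0 y.
    by apply/eqP; rewrite -subr_eq0; apply/eqP; exact: (uv0 y y0).1.
  have [h _] := uv0 (- y) (ltac:(by rewrite oppr_ge0)).
  by apply/eqP; rewrite -subr_eq0 -h /u !char_cosN.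
- have [y0|/ltW y0] := leP 0 y.
    by apply/eqP; rewrite -subr_eq0; apply/eqP; exact: (uv0 y y0).2.
  have [_ h] := uv0 (- y) (ltac:(by rewrite oppr_ge0)).
  apply/eqP; rewrite -subr_eq0 -oppr_eq0; apply/eqP.
  by rewrite -h /v !char_sinN; ring.
Qed.

End stein_characteristic.

(** * Transfer between equal laws, and expectations *)

Section transfer.
Context {R : realType} d (T : measurableType d) d' (T' : measurableType d').
Variables (P : probability T R) (Z : {RV P >-> R}).
Variables (Q : probability T' R) (W : {RV Q >-> R}).
Hypothesis WZ : equal_in_law W Z.

Lemma equal_in_law_mean0 (g : R -> R) : measurable_fun [set: R] g ->
  mean0 P (fun t => g (Z t)) -> mean0 Q (fun t => g (W t)).
Proof.
move=> mg [iZ eZ].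
have WZE (f : R -> \bar R) :
    (\int[distribution Q W]_x f x = \int[distribution P Z]_x f x)%E.
  by apply: eq_measure_integral => A mA _; exact: WZ.
have mgE : measurable_fun [set: R] (EFin \o g) by exact/measurable_EFinP.
have mgW : measurable_fun [set: T'] (fun t => g (W t)).
  exact: (measurableT_comp mg (measurable_funPT W)).
have iW : Q.-integrable [set: T'] (EFin \o (fun t => g (W t))).
  apply/integrableP; split; first exact/measurable_EFinP.
  have mga : measurable_fun [set: R] (fun x => `|(g x)%:E|%E).
    exact: measurableT_comp.
  rewrite -(ge0_integral_distribution W mga)// WZE ge0_integral_distribution//.
  by have /integrableP[] := iZ.
split=> //; rewrite -eZ /Rintegral; congr fine.
rewrite -(integral_distribution (X := W) mgE iW) WZE.
exact: (integral_distribution (X := Z) mgE iZ).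
Qed.

End transfer.

Section expectations.
Context {R : realType} d (T : measurableType d) (P : probability T R).
Implicit Types g : T -> R.

Lemma expectation_integral g : ('E_P[g] = \int[P]_t (g t)%:E)%E.
Proof. by rewrite unlock. Qed.

Lemma mean0_has_expectation g : mean0 P g <-> has_expectation P g 0%E.
Proof.
rewrite /mean0 /has_expectation expectation_integral; split=> -[ig g0]; split=> //.
  by rewrite integral_EFinE// g0.
by rewrite /Rintegral g0.
Qed.

Lemma expectation_norm_lty g : measurable_fun [set: T] g ->
  P.-integrable [set: T] (EFin \o g) <-> ('E_P[fun t => `|g t|%R] < +oo)%E.
Proof.
move=> mg; rewrite expectation_integral; split=> [/integrableP[]//|goo].
by apply/integrableP; split; first exact/measurable_EFinP.
Qed.

Lemma equal_moments_integrable d' (T' : measurableType d') (Q : probability T' R)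
    (W : {RV P >-> R}) (Z : {RV Q >-> R}) n :
  (0 < n)%N -> equal_moments n W Z -> P.-integrable [set: T] (EFin \o W).
Proof. by move=> n0 /(_ 1%N n0)[]. Qed.

End expectations.

Lemma measurable_jet_op4 (R : realType) (muX muY : R) (F : nat -> R -> R) :
  (forall k, (k <= 4)%N -> continuous (F k)) ->
  measurable_fun [set: R] (jet_op 4 (stein_coef4 muX muY) F).
Proof.
move=> cF; rewrite (funext (jet_op4E muX muY F)).
have mF k : (k <= 4)%N -> measurable_fun [set: R] (F k).
  by move=> k4; apply: continuous_measurable_fun; exact: cF.
by repeat first [exact: mF | exact: measurable_cst | exact: measurable_id
  | apply: measurable_funB | apply: measurable_funD | apply: measurable_funM].
Qed.

Lemma measurable_jet_op3 (R : realType) (mu : R) (F : nat -> R -> R) :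
  (forall k, (k <= 3)%N -> continuous (F k)) ->
  measurable_fun [set: R] (jet_op 3 (stein_coef3 mu) F).
Proof.
move=> cF; rewrite (funext (jet_op3E mu F)).
have mF k : (k <= 3)%N -> measurable_fun [set: R] (F k).
  by move=> k4; apply: continuous_measurable_fun; exact: cF.
by repeat first [exact: mF | exact: measurable_cst | exact: measurable_id
  | apply: measurable_funB | apply: measurable_funD | apply: measurable_funM].
Qed.

(** Makes trigonometric functions admissible in the theorem: their derivatives are bounded, so
    integrability of [Z] is enough. *)
Lemma integrable_trig_jet (R : realType) d (T : measurableType d)
    (P : probability T R) (Z : {RV P >-> R}) (y a b : R) k :
  P.-integrable [set: T] (EFin \o Z) ->
  P.-integrable [set: T] (EFin \o (fun t => Z t * trig_jet y a b k (Z t))) /\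
  P.-integrable [set: T] (EFin \o (fun t => trig_jet y a b k (Z t))).
Proof.
move=> iZ; have [B trigB] := trig_jet_bounded y a b k.
have mZ : measurable_fun [set: T] Z by exact: measurable_funPT.
have mt : measurable_fun [set: T] (fun t => trig_jet y a b k (Z t)).
  apply: (measurableT_comp _ mZ); apply: continuous_measurable_fun.
  exact: (jet_trig k y a b).2.
split; last exact: (@integrable_bounded _ _ _ P _ B mt).
apply: (integrable_le (g := fun t => B * `|Z t|)).
- exact: measurable_funM.
- by move=> t; rewrite normrM mulrC ler_wpM2r.
- by apply: integrable_EFinZl; exact: integrable_norm.
Qed.

Theorem proposition3p3 (R : realType) (d : measure_display)
    (T : measurableType d) (P : probability T R) (X Y Z : {RV P >-> R})
    (muX muY : R)
    (hX : has_law X (normal_prob muX 1)) (hY : has_law Y (normal_prob muY 1))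
    (hXY : independent_RV X Y) (hZ : forall t : T, Z t = X t * Y t) :
  (forall (d' : measure_display) (T' : measurableType d')
      (Q : probability T' R) (W : {RV Q >-> R}),
    equal_moments 3 W Z ->
    (equal_in_law W Z <->
     forall f : R -> R, class_C 4 f ->
       (forall j : nat, (j <= 4)%N ->
          ('E_P[fun t => `|Z t * derive1n j f (Z t)|%R] < +oo)%E) ->
       (forall k : nat, (k <= 3)%N ->
          ('E_P[fun t => `|derive1n k f (Z t)|%R] < +oo)%E) ->
       has_expectation Q
         (fun t => W t * derive1n 4 f (W t) + derive1n 3 f (W t)
            - (2 * W t + muX * muY) * derive1n 2 f (W t)
            - (1 + muX ^+ 2 + muY ^+ 2) * derive1n 1 f (W t)
            + (W t - muX * muY) * f (W t)) 0%E))
  /\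
  (forall mu : R, muX = mu -> muY = mu ->
    forall (d' : measure_display) (T' : measurableType d')
      (Q : probability T' R) (W : {RV Q >-> R}),
    equal_moments 2 W Z ->
    (equal_in_law W Z <->
     forall f : R -> R, class_C 3 f ->
       (forall j : nat, (j <= 3)%N ->
          ('E_P[fun t => `|Z t * derive1n j f (Z t)|%R] < +oo)%E) ->
       (forall k : nat, (k <= 2)%N ->
          ('E_P[fun t => `|derive1n k f (Z t)|%R] < +oo)%E) ->
       has_expectation Q
         (fun t => W t * derive1n 3 f (W t) + (1 - W t) * derive1n 2 f (W t)
            - (W t + 1 + mu ^+ 2) * derive1n 1 f (W t)
            + (W t - mu ^+ 2) * f (W t)) 0%E)).
Proof.
have iZ : P.-integrable [set: T] (EFin \o Z).
  by rewrite (funext hZ : Z = _ :> (T -> R)); exact: integrable_mul hX hY hXY.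
have mZ : measurable_fun [set: T] Z by exact: measurable_funPT.
have intZ n f : class_C n f ->
    (forall j, (j <= n)%N ->
      ('E_P[fun t => `|Z t * derive1n j f (Z t)|%R] < +oo)%E) ->
    forall j, (j <= n)%N ->
      P.-integrable [set: T] (EFin \o (fun t => Z t * derive1n j f (Z t))).
  move=> Cf h j jn; apply/expectation_norm_lty; last exact: h.
  apply: measurable_funM => //; apply: (measurableT_comp _ mZ).
  by apply: continuous_measurable_fun; exact: Cf.2.
have intf n m f : (m <= n)%N -> class_C n f ->
    (forall k, (k <= m)%N -> ('E_P[fun t => `|derive1n k f (Z t)|%R] < +oo)%E) ->
    forall k, (k <= m)%N ->
      P.-integrable [set: T] (EFin \o (fun t => derive1n k f (Z t))).
  move=> mn Cf h k km; apply/expectation_norm_lty; last exact: h.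
  apply: (measurableT_comp _ mZ); apply: continuous_measurable_fun.
  by apply: Cf.2; exact: leq_trans mn.
have trigC n (y a b : R) : class_C n (trig_jet y a b 0).
  exact: jet_class_C (jet_trig n y a b).
have trigE n (y a b : R) : (n <= 4)%N -> derive1n n (trig_jet y a b 0) = trig_jet y a b n.
  by move=> n4; exact: derive1n_jet (jet_trig 4 y a b) n4.
have trigZ y a b j : (j <= 4)%N ->
    ('E_P[fun t => `|Z t * derive1n j (trig_jet y a b 0) (Z t)|%R] < +oo)%E.
  move=> j4; rewrite trigE//.
  have [h _] := integrable_trig_jet y a b j iZ.
  by apply/expectation_norm_lty => //; have /integrableP[/measurable_EFinP] := h.
have trig y a b j : (j <= 4)%N ->
    ('E_P[fun t => `|derive1n j (trig_jet y a b 0) (Z t)|%R] < +oo)%E.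
  move=> j4; rewrite trigE//.
  have [_ h] := integrable_trig_jet y a b j iZ.
  by apply/expectation_norm_lty => //; have /integrableP[/measurable_EFinP] := h.
(* The necessity argument shows that [Z] itself satisfies the trigonometric identities against which
   [W] is compared. *)
have Z0 : stein_null muX muY Z.
  move=> y a b; apply: (mean0_stein4 hX hY hXY hZ (jet_trig 4 y a b) _ _).2.
    by move=> k _; exact: (integrable_trig_jet y a b k iZ).1.
  by move=> k _; exact: (integrable_trig_jet y a b k iZ).2.
split.
  move=> d' T' Q W /(equal_moments_integrable (isT : (0 < 3)%N)) iW; split.
    move=> WZ f Cf hZf hf; apply/mean0_has_expectation.
    have jf := class_C_jet Cf.
    under eq_fun do rewrite -(jet_op4E muX muY (fun k => derive1n k f)).
    (* The identity is established for [Z] and carried over to [W] by equality in law. *)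
    apply: (equal_in_law_mean0 WZ
      (g := jet_op 4 (stein_coef4 muX muY) (fun k => derive1n k f))).
      by apply: measurable_jet_op4; exact: jf.2.
    apply: (mean0_stein4 hX hY hXY hZ jf); first exact: intZ.
    exact: (intf 4).
  move=> H; apply: (stein_null_unique iZ iW Z0) => y a b.
  have := H _ (trigC 4 y a b) (fun j => trigZ y a b j)
    (fun k k3 => trig y a b k (leqW k3)).
  move=> /mean0_has_expectation[_]; rewrite !trigE// => <-.
  by apply: eq_Rintegral => t _; rewrite jet_op4E.
move=> mu eX eY d' T' Q W /(equal_moments_integrable (isT : (0 < 2)%N)) iW; split.
  move=> WZ f Cf hZf hf; apply/mean0_has_expectation.
  have jf := class_C_jet Cf.
  under eq_fun do rewrite -(jet_op3E mu (fun k => derive1n k f)).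
  apply: (equal_in_law_mean0 WZ
      (g := jet_op 3 (stein_coef3 mu) (fun k => derive1n k f))).
      by apply: measurable_jet_op3; exact: jf.2.
  apply: (mean0_stein3 hX hY hXY hZ eX eY jf); first exact: intZ.
  exact: (intf 3).
move=> H; apply: (stein_null_unique iZ iW Z0) => y a b.
(* These are the coefficients of [f + f'] for [f = a * cos (y * x) + b * sin (y * x)], so the
   third-order identity yields the fourth-order one for [f]. *)
have := H _ (trigC 3 y (a + y * b) (b - y * a))
  (fun j j3 => trigZ y _ _ j (leqW j3))
  (fun k k2 => trig y _ _ k (leqW (leqW k2))).
move=> /mean0_has_expectation[_]; rewrite !trigE// => <-.
by apply: eq_Rintegral => t _; rewrite eX eY -jet_op3_trig jet_op3E.
Qed.
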